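(* For all $h,o,\gamma>0$, integers $r\ge2$ and $0<\mu\le1$ there is a constant $c_3$, depending only on $h,o,r,\mu,\gamma$, such that the following holds. Let $\Lambda$ be a finite lattice with $N$ sites carrying a quantum system $(H_\Lambda,C_\Lambda,O^{(1)}_\Lambda,O^{(2)}_\Lambda)$, and let $\Phi_\Lambda$ be a normalized simultaneous eigenstate of $H_\Lambda$ and $C_\Lambda$ with $H_\Lambda\Phi_\Lambda=E_\Lambda\Phi_\Lambda$, such that conditions i)–vi) of the context hold with constants $h,o,r,\mu,\gamma$. Let $M$ be a nonzero integer with $$\frac{M^2}{N}\le c_2:=\min\left\{\frac{\mu^2}{192\,r},\ \frac{o\mu}{\sqrt{24\gamma}}\right\}.$$ Then $(O^+_\Lambda)^M\Phi_\Lambda\ne0$, so that $$\Psi^{(M)}_\Lambda:=\frac{(O^+_\Lambda)^M\Phi_\Lambda}{\|(O^+_\Lambda)^M\Phi_\Lambda\|}$$ is well-defined, and $$\frac1N\left|(\Psi^{(M)}_\Lambda,H_\Lambda\Psi^{(M)}_\Lambda)-E_\Lambda\right|\le c_3\left(\frac MN\right)^2.$$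
   Context: Setting. $\Lambda$ is a finite set of $N$ sites; to each $x\in\Lambda$ is associated a finite-dimensional Hilbert space $\mathcal H_x$, and $\mathcal H_\Lambda=\bigotimes_{x\in\Lambda}\mathcal H_x$. $\|\cdot\|$ is the Hilbert space norm or the operator norm. The Hamiltonian is $H_\Lambda=\sum_{x\in\Lambda}h_x$ with each $h_x$ a self-adjoint operator on $\mathcal H_\Lambda$. $C_\Lambda$ is a self-adjoint operator on $\mathcal H_\Lambda$ with $[H_\Lambda,C_\Lambda]=0$. The order operators are $O^{(\alpha)}_\Lambda=\sum_{x\in\Lambda}o^{(\alpha)}_x$, $\alpha=1,2$, with each $o^{(\alpha)}_x$ self-adjoint on $\mathcal H_\Lambda$; they satisfy $$[O^{(1)}_\Lambda,C_\Lambda]=-iO^{(2)}_\Lambda,\qquad [O^{(2)}_\Lambda,C_\Lambda]=iO^{(1)}_\Lambda.$$ $O^\pm_\Lambda:=O^{(1)}_\Lambda\pm iO^{(2)}_\Lambda$, and for negative $M$ one sets $(O^+_\Lambda)^M:=(O^-_\Lambda)^{|M|}$ (this is notation, not an inverse). Conditions: i) $[o^{(\alpha)}_x,o^{(\beta)}_y]=0$ for $x\ne y$ and $\alpha,\beta\in\{1,2\}$. ii) For each $x\in\Lambda$ there is a support set $\mathcal S_x\subset\Lambda$ with at most $r$ sites ($r\ge2$ an integer independent of $x$) such that $[h_x,o^{(\alpha)}_y]=0$ for $\alpha=1,2$ unless $y\in\mathcal S_x$. iii) $\|h_x\|\le h$ and $\|o^{(\alpha)}_x\|\le o$ for all $x\in\Lambda$,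 $\alpha=1,2$, with constants $h,o>0$ independent of $x$. iv) (Long range order) $(\Phi_\Lambda,(O^{(1)}_\Lambda)^2\Phi_\Lambda)=(\Phi_\Lambda,(O^{(2)}_\Lambda)^2\Phi_\Lambda)\ge(\mu oN)^2$ with a constant $0<\mu\le1$. v) $[O^{(1)}_\Lambda,O^{(2)}_\Lambda]=i\gamma C_\Lambda$ with a constant $\gamma>0$. vi) With $U_\Lambda=\exp[i(\pi/\sqrt\gamma)O^{(1)}_\Lambda]$, one has $U_\Lambda H_\Lambda U_\Lambda^{-1}=H_\Lambda$ and $U_\Lambda\Phi_\Lambda\propto\Phi_\Lambda$. *)

(* Defs.v *)
From mathcomp Require Import all_boot all_order all_algebra.
From mathcomp Require Import complex.
From mathcomp Require Import all_classical all_reals all_analysis.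
Import Order.TTheory GRing.Theory Num.Theory numFieldNormedType.Exports.

Set Implicit Arguments.
Unset Strict Implicit.
Unset Printing Implicit Defensive.

Local Open Scope classical_set_scope.
Local Open Scope sesquilinear_scope.
Local Open Scope complex_scope.
Local Open Scope ring_scope.

(* H_x is identified with C^(d x) by an orthonormal basis.  The corresponding
   product basis of the tensor product of all the H_x is indexed by the
   configurations (one basis label per site), so H_Lambda is identified with
   C^(hdim d), hdim d being the number of configurations. *)
Definition hdim (L : finType) (d : L -> nat) : nat :=
  #|{dffun forall x : L, 'I_(d x)}|.

Notation vec R d := 'cV[R[i]]_(hdim d).
Notation op R d := 'M[R[i]]_(hdim d).

(* The index alpha = 1, 2 of the order operators. *)
Variant axis := axis1 | axis2.

Definition commutator (K : pzRingType) (n : nat) (A B : 'M[K]_n) : 'M[K]_n :=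
  A *m B - B *m A.

(* The sum of the power series of exp, in the topology of 'M[K]_n. *)
Definition expmx (K : numFieldType) (n : nat) (A : 'M[K]_n) : 'M[K]_n :=
  limn (fun m : nat => \sum_(k < m) (k`!%:R)^-1 *: A ^+ k : 'M[K]_n).

Section Hilbert.
Context {R : realType} {n : nat}.
Implicit Types (u v : 'cV[R[i]]_n) (A : 'M[R[i]]_n).

(* Antilinear in the first argument. *)
Definition inner u v : R[i] := (u ^t* *m v) ord0 ord0.

Definition hnorm v : R := Num.sqrt (complex.Re (inner v v)).

(* The norm induced by hnorm; the norm that the library puts on matrices is
   the maximum of the moduli of the entries. *)
Definition opnorm A : R := sup [set hnorm (A *m v) | v in [set v | hnorm v <= 1]].

End Hilbert.

Section Order.
Context {R : realType} {L : finType} {d : L -> nat}.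

Definition hamiltonian (h : L -> op R d) : op R d := \sum_x h x.

Definition order_op (o : axis -> L -> op R d) (a : axis) : op R d := \sum_x o a x.

Definition raising (o : axis -> L -> op R d) : op R d :=
  order_op o axis1 + 'i *: order_op o axis2.

Definition lowering (o : axis -> L -> op R d) : op R d :=
  order_op o axis1 - 'i *: order_op o axis2.

(* (O^+)^M; a negative M stands for the |M|-th power of O^-, not for an
   inverse. *)
Definition raising_pow (o : axis -> L -> op R d) (M : int) : op R d :=
  if 0 <= M then raising o ^+ `|M|%N else lowering o ^+ `|M|%N.

End Order.

(* Main.v *)
(** Write [A = O^+], [B = O^-].  With [C] they span a copy of su(2), and condition
    vi) rotates [C] into [-C], so that [Phi] has weight 0 and [A^m Phi], [B^m Phi]
    have the same norm and the same energy.

    Lower bound on the norms.  The Casimir operator [T = O1^2 + O2^2 + g C^2]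
    commutes with [A] and [B], and [B A^(k+1) Phi = (T - g k (k+1)) A^k Phi].  By
    Cauchy-Schwarz the Rayleigh quotients of [T] at the [A^k Phi] are
    nondecreasing in [k]; the first is at least [2 (mu o N)^2], so that
    [|A^(k+1) Phi| >= mu o N |A^k Phi|] as long as [g k (k+1) <= (mu o N)^2].

    Upper bound on the energy.  Since [A^m Phi] and [B^m Phi] have equal energies,
    twice the energy shift is a sum over the sites of double-commutator
    expectations.  Moving a power of [A] across a local operator [X] replaces [X]
    by iterated commutators, each at most [4 o r] times as large as the previous
    one, while each factor [A] that is lost gains [1 / (mu o N)].  Hence all the
    expectations can be reordered to pair [A^i Phi] with [A^j Phi] (or [B^j Phi]),
    at the cost of factors [(1 + 4 r / (mu N))^m = O(1)].  The terms of first order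
    in [m / N] cancel between [A] and [B], up to the commutator
    [B^(k+1) A^k Phi - A^k B^(k+1) Phi = g k (k+1) A^(k-1) B^k Phi], which is of
    higher order. *)
Require Import Defs.
From mathcomp Require Import all_boot all_order all_algebra.
From mathcomp Require Import complex ring lra.
From mathcomp Require Import all_classical all_reals all_analysis.
Import Order.TTheory GRing.Theory Num.Theory numFieldNormedType.Exports.

Set Implicit Arguments.
Unset Strict Implicit.
Unset Printing Implicit Defensive.

Local Open Scope sesquilinear_scope.
Local Open Scope complex_scope.
Local Open Scope ring_scope.

(** * Inner product, norms and form bounds for operators *)

Section InnerProduct.
Context {R : realType} {n : nat}.
Implicit Types (u v w : 'cV[R[i]]_n) (A B X : 'M[R[i]]_n) (z : R[i]).

(** The modulus as an element of [R] rather than of [R[i]], so that all estimates are inequalities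
    between reals. *)
Definition cmod z : R := complex.Re `|z|.

Lemma cmodE z : `|z| = (cmod z)%:C.
Proof. by rewrite /cmod RRe_real ?normr_real. Qed.

Lemma cmod_ge0 z : 0 <= cmod z.
Proof. by rewrite -lecR -cmodE normr_ge0. Qed.

Lemma cmodD z1 z2 : cmod (z1 + z2) <= cmod z1 + cmod z2.
Proof. by rewrite -lecR rmorphD /= -!cmodE ler_normD. Qed.

Lemma cmodM z1 z2 : cmod (z1 * z2) = cmod z1 * cmod z2.
Proof. by apply: complexI; rewrite rmorphM /= -!cmodE normrM. Qed.

Lemma cmodN z : cmod (- z) = cmod z.
Proof. by rewrite /cmod normrN. Qed.

Lemma cmod_real (x : R) : 0 <= x -> cmod x%:C = x.
Proof. by move=> x0; rewrite /cmod ger0_norm ?lecR. Qed.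

Lemma cmodJ z : cmod z^*%R = cmod z.
Proof. by rewrite /cmod norm_conjC. Qed.

Lemma Re_le_cmod z : `|complex.Re z| <= cmod z.
Proof. by rewrite -lecR -cmodE normc_ge_Re. Qed.

Lemma innerDr u v w : inner u (v + w) = inner u v + inner u w.
Proof. by rewrite /inner mulmxDr mxE. Qed.

Lemma innerNr u v : inner u (- v) = - inner u v.
Proof. by rewrite /inner mulmxN mxE. Qed.

Lemma innerBr u v w : inner u (v - w) = inner u v - inner u w.
Proof. by rewrite innerDr innerNr. Qed.

Lemma innerZr z u v : inner u (z *: v) = z * inner u v.
Proof. by rewrite /inner -scalemxAr mxE. Qed.

Lemma innerC u v : inner v u = (inner u v)^*%R.
Proof.
rewrite /inner !mxE rmorph_sum; apply: eq_bigr => i _.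
by rewrite !mxE rmorphM /= conjCK mulrC.
Qed.

Lemma innerZl z u v : inner (z *: u) v = z^*%R * inner u v.
Proof. by rewrite innerC innerZr rmorphM /= -innerC. Qed.

Lemma inner_suml (I : finType) (F : I -> 'M[R[i]]_n) u v :
  inner u ((\sum_i F i) *m v) = \sum_i inner u (F i *m v).
Proof. by rewrite /inner mulmx_suml mulmx_sumr summxE. Qed.

Lemma inner_adj A u v : inner (A *m u) v = inner u (A^t* *m v).
Proof. by rewrite /inner trmx_mul map_mxM -mulmxA. Qed.

Lemma inner_adjr A u v : inner u (A *m v) = inner (A^t* *m u) v.
Proof. by rewrite inner_adj trmxCK. Qed.

Lemma innervE v : inner v v = (\sum_i cmod (v i ord0) ^+ 2)%:C.
Proof.
rewrite /inner !mxE rmorph_sum; apply: eq_bigr => i _.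
by rewrite !mxE rmorphXn /= -cmodE normCKC.
Qed.

Lemma hnorm_sum v : hnorm v ^+ 2 = \sum_i cmod (v i ord0) ^+ 2.
Proof. by rewrite /hnorm innervE sqr_sqrtr //= sumr_ge0// => i _; rewrite sqr_ge0. Qed.

Lemma inner_hnorm v : inner v v = (hnorm v ^+ 2)%:C.
Proof. by rewrite hnorm_sum innervE. Qed.

Lemma hnorm_ge0 v : 0 <= hnorm v.
Proof. exact: sqrtr_ge0. Qed.

Lemma hnorm0 : hnorm (0 : 'cV[R[i]]_n) = 0.
Proof. by rewrite /hnorm /inner mulmx0 mxE /= sqrtr0. Qed.

Lemma hnorm_eq0 v : hnorm v = 0 -> v = 0.
Proof.
move=> v0; have := hnorm_sum v; rewrite v0 expr0n /= => /esym/eqP.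
rewrite psumr_eq0; last by move=> i _; rewrite sqr_ge0.
move=> /allP h; apply/matrixP => i j; rewrite ord1 mxE.
have := h i (mem_index_enum i); rewrite sqrf_eq0 /= => /eqP vi.
by apply/eqP; rewrite -normr_eq0 cmodE vi.
Qed.

Lemma hnormZ z v : hnorm (z *: v) = cmod z * hnorm v.
Proof.
apply/eqP; rewrite -(@eqrXn2 _ 2) ?mulr_ge0 ?hnorm_ge0 ?cmod_ge0//.
apply/eqP/complexI; rewrite -inner_hnorm innerZl innerZr mulrA -normCKC cmodE.
by rewrite inner_hnorm exprMn [RHS]rmorphM [in RHS]rmorphXn.
Qed.

Lemma cauchy_schwarz u v : cmod (inner u v) <= hnorm u * hnorm v.
Proof.
have [->|v0] := eqVneq v 0.
  by rewrite /inner mulmx0 mxE hnorm0 mulr0 /cmod normr0.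
have hv : 0 < hnorm v.
  rewrite lt_neqAle hnorm_ge0 andbT eq_sym; apply: contra_neq v0; exact: hnorm_eq0.
set a := inner v u; set b := hnorm v ^+ 2.
have b0 : 0 < b by rewrite exprn_gt0.
(* Expanding this square gives [b (b |u|^2 - |a|^2)] with [b > 0]. *)
have : 0 <= inner (b%:C *: u - a *: v) (b%:C *: u - a *: v).
  by rewrite inner_hnorm lecR sqr_ge0.
rewrite innerBr !innerZr [inner (_ - _) u]innerC [inner (_ - _) v]innerC.
rewrite !innerBr !innerZr [inner u v]innerC -/a !inner_hnorm -/b.
set c := hnorm u ^+ 2.
have -> : b%:C * (b%:C * c%:C - a * a^*)^*%R - a * (b%:C * a - a * b%:C)^*%R
    = (b * (b * c - cmod a ^+ 2))%:C.
  have conjR (x : R) : (x%:C)^*%R = x%:C :> R[i] by exact: conjc_real.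
  rewrite !(rmorphXn, rmorphB, rmorphM) /= conjCK !conjR -cmodE normCK; ring.
rewrite lecR pmulr_rge0 // subr_ge0 => h.
rewrite cmodJ -(@ler_pXn2r _ 2) ?nnegrE ?mulr_ge0 ?hnorm_ge0 ?cmod_ge0//.
by rewrite exprMn -/b -/c mulrC.
Qed.

Lemma hnorm_unitary (U : 'M[R[i]]_n) v : U^t* *m U = 1%:M -> hnorm (U *m v) = hnorm v.
Proof. by move=> hU; rewrite /hnorm inner_adj mulmxA hU mul1mx. Qed.

(** The form version of an operator norm bound; it passes to sums and products without handling a
    supremum. *)
Definition op_bounded (c : R) X :=
  forall u v, cmod (inner u (X *m v)) <= c * hnorm u * hnorm v.

Lemma op_boundedP c X : 0 <= c ->
  (forall v, hnorm (X *m v) <= c * hnorm v) -> op_bounded c X.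
Proof.
move=> c0 hX u v; apply: le_trans (cauchy_schwarz _ _) _.
by rewrite [c * _]mulrC -mulrA ler_wpM2l ?hnorm_ge0.
Qed.

(** Testing the form with [u = X v] gives [|X v|^2 <= c |X v| |v|], and a nonzero [|X v|]
    cancels. *)
Lemma op_bounded_hnorm c X v : op_bounded c X -> hnorm (X *m v) <= c * hnorm v.
Proof.
move=> hX; have := hX (X *m v) v.
rewrite inner_hnorm cmod_real ?sqr_ge0// expr2.
have [->|x0] := eqVneq (hnorm (X *m v)) 0.
  have := hX v v; have := cmod_ge0 (inner v (X *m v)).
  have := hnorm_ge0 v; rewrite le_eqVlt => /orP[/eqP<-|v0 h1 h2].
    by rewrite !mulr0.
  by rewrite -(pmulr_lge0 _ v0) (le_trans h1 h2).
by rewrite mulrAC ler_pM2r // lt_neqAle eq_sym x0 hnorm_ge0.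
Qed.

Lemma op_boundedD c1 c2 X1 X2 :
  op_bounded c1 X1 -> op_bounded c2 X2 -> op_bounded (c1 + c2) (X1 + X2).
Proof.
move=> h1 h2 u v; rewrite mulmxDl innerDr; apply: le_trans (cmodD _ _) _.
by rewrite !mulrDl lerD.
Qed.

Lemma op_boundedN c X : op_bounded c X -> op_bounded c (- X).
Proof. by move=> h u v; rewrite mulNmx innerNr cmodN. Qed.

Lemma op_boundedZ c z X : op_bounded c X -> op_bounded (cmod z * c) (z *: X).
Proof.
move=> h u v; rewrite -scalemxAl innerZr cmodM -!mulrA ler_wpM2l ?cmod_ge0//.
by rewrite mulrA.
Qed.

Lemma op_boundedM c1 c2 X1 X2 : 0 <= c1 ->
  op_bounded c1 X1 -> op_bounded c2 X2 -> op_bounded (c1 * c2) (X1 *m X2).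
Proof.
move=> c10 h1 h2 u v; rewrite -mulmxA; apply: le_trans (h1 _ _) _.
have -> : c1 * c2 * hnorm u * hnorm v = c1 * hnorm u * (c2 * hnorm v) by ring.
by rewrite ler_wpM2l ?mulr_ge0 ?hnorm_ge0 ?op_bounded_hnorm.
Qed.

Lemma op_bounded0 : op_bounded 0 0.
Proof. by move=> u v; rewrite mul0mx /inner mulmx0 mxE /cmod normr0 !mul0r. Qed.

Lemma op_bounded_sum (I : finType) (S : {set I}) c (F : I -> 'M[R[i]]_n) :
  (forall i, op_bounded c (F i)) -> op_bounded (#|S|%:R * c) (\sum_(i in S) F i).
Proof.
move=> hF; rewrite mulr_natl -sumr_const.
apply: (big_ind2 op_bounded) => //; first exact: op_bounded0.
by move=> *; exact: op_boundedD.
Qed.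

Lemma opnorm_bounded X c : opnorm X <= c -> op_bounded c X.
Proof.
move=> hX.
set E := [set hnorm (X *m v) | v in [set v | hnorm v <= 1]]%classic.
have hE : has_sup E.
  split; first by exists (hnorm (X *m 0)); exists 0; rewrite //= hnorm0.
  (* The supremum bounds its set only if some bound exists. Entries of [v] have modulus at most 1,
     so [|X v|^2 <= s], and [x <= 1 + x^2]. *)
  exists (1 + \sum_i (\sum_j cmod (X i j)) ^+ 2) => _ [v /= v1 <-].
  set s := \sum_i _; suff h : hnorm (X *m v) ^+ 2 <= s.
    have := sqr_ge0 (hnorm (X *m v) - 1); nra.
  rewrite hnorm_sum; apply: ler_sum => i _.
  rewrite ler_pXn2r ?nnegrE ?cmod_ge0 ?sumr_ge0 //; last by move=> *; exact: cmod_ge0.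
  rewrite mxE -lecR -cmodE rmorph_sum /=; apply: le_trans (ler_norm_sum _ _ _) _.
  apply: ler_sum => j _; rewrite normrM !cmodE -rmorphM lecR ler_piMr ?cmod_ge0//.
  rewrite -(@ler_pXn2r _ 2) ?nnegrE ?cmod_ge0// expr1n.
  apply: le_trans (_ : hnorm v ^+ 2 <= _); last by rewrite expr_le1 ?hnorm_ge0.
  rewrite hnorm_sum (bigD1 j) //= lerDl sumr_ge0// => k _; exact: sqr_ge0.
have hb v : hnorm v <= 1 -> hnorm (X *m v) <= c.
  move=> v1; apply: le_trans hX; apply: ub_le_sup; first exact: hE.2.
  by exists v.
have c0 : 0 <= c by have := hb 0; rewrite mulmx0 hnorm0 ler01 => /(_ isT).
apply: op_boundedP => // v.
have := hnorm_ge0 v; rewrite le_eqVlt => /orP[/eqP v0|v0].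
  by rewrite -v0 (hnorm_eq0 (esym v0)) mulmx0 hnorm0 mulr0.
have := hb ((hnorm v)^-1%:C *: v); rewrite -scalemxAr !hnormZ cmod_real ?invr_ge0 ?hnorm_ge0//.
rewrite mulVf ?gt_eqF// lexx => /(_ isT).
by rewrite ler_pdivrMl// mulrC.
Qed.

End InnerProduct.

(** * Matrices diagonal in a unitary basis *)

Section DiagonalConjugation.
Context {C : numClosedFieldType} {n : nat}.
Implicit Types (P A B : 'M[C]_n) (l e : 'rV[C]_n).

Lemma unitary_conjmx_diag_pow P l z k : P \is unitarymx ->
  (z *: (P^t* *m diag_mx l *m P)) ^+ k = P^t* *m diag_mx (\row_j (z * l ord0 j) ^+ k) *m P.
Proof.
move=> uP; have PP : P *m P^t* = 1%:M by apply/unitarymxP.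
elim: k => [|k ih].
  have -> : \row_j (z * l ord0 j) ^+ 0 = const_mx 1 by apply/rowP => j; rewrite !mxE expr0.
  by rewrite diag_const_mx mulmx1 expr0 (mulmx1C PP).
rewrite exprS ih -mulmxE -!scalemxAl -!mulmxA (mulmxA P) PP mul1mx !mulmxA.
rewrite -(mulmxA _ (diag_mx _) (diag_mx _)) mulmx_diag scalemxAl scalemxAr.
congr (_ *m _ *m _); apply/matrixP => i j; rewrite !mxE.
by case: eqP => _ //; rewrite ?mulr0n ?mulr0// !mulr1n exprS mulrA.
Qed.

(* In an eigenbasis of [A], the relation [[A, [A, B]] = g B] says that an entry
   [B i j] vanishes unless [(l i - l j)^2 = g]. *)
Lemma unitary_conjmx_diag_anticomm P B l e g : P \is unitarymx ->
  let A := P^t* *m diag_mx l *m P in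
  let U := P^t* *m diag_mx e *m P in
  commutator A (commutator A B) = g *: B ->
  (forall i j, (l ord0 i - l ord0 j) ^+ 2 = g -> e ord0 i = - e ord0 j) ->
  (forall i, (e ord0 i)^* * e ord0 i = 1) ->
  [/\ U^t* *m U = 1%:M, U *m A = A *m U & U *m B = - (B *m U)].
Proof.
move=> uP A U hB el e1; rewrite {}/A {}/U in hB *.
have PP : P *m P^t* = 1%:M by apply/unitarymxP.
have P'P : P^t* *m P = 1%:M by apply: mulmx1C.
set D := diag_mx l in hB *; set F := diag_mx e.
split.
- rewrite !trmx_mul !map_mxM trmxCK tr_diag_mx map_diag_mx.
  rewrite !mulmxA -(mulmxA _ P) PP mulmx1 -(mulmxA _ (diag_mx _)) mulmx_diag.
  rewrite [X in diag_mx X](_ : _ = const_mx 1).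
    by rewrite diag_const_mx mulmx1.
  by apply/matrixP => i j; rewrite !mxE e1.
- rewrite !mulmxA -(mulmxA _ P) PP -(mulmxA _ P _) PP !mulmx1.
  by rewrite -(mulmxA _ F D) diag_mxC mulmxA.
pose B' := P *m B *m P^t*.
have BE : B = P^t* *m B' *m P by rewrite /B' !mulmxA P'P mul1mx -mulmxA P'P mulmx1.
have comB : D *m (D *m B' - B' *m D) - (D *m B' - B' *m D) *m D = g *: B'.
  have PM X : P *m (P^t* *m D *m P *m X) *m P^t* = D *m (P *m X *m P^t*).
    by rewrite !mulmxA PP mul1mx.
  have MP X : P *m (X *m (P^t* *m D *m P)) *m P^t* = (P *m X *m P^t*) *m D.
    by rewrite !mulmxA -(mulmxA _ P) PP mulmx1.
  have := congr1 (fun X => P *m X *m P^t*) hB; rewrite /commutator /=.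
  by rewrite !(mulmxBl, mulmxBr) !(PM, MP) -scalemxAr -scalemxAl.
clearbody B'.
have FB : F *m B' = - (B' *m F).
  apply/matrixP => i j; have := congr1 (fun X : 'M[C]_n => X i j) comB.
  rewrite !(mul_diag_mx, mul_mx_diag) !mxE.
  have [->|b0] := eqVneq (B' i j) 0; first by rewrite !(mulr0, mul0r) oppr0.
  move=> h; suff /el -> : (l ord0 i - l ord0 j) ^+ 2 = g by rewrite mulNr mulrC.
  by apply: (mulIf b0); rewrite -h; ring.
rewrite BE !mulmxA -(mulmxA _ P) PP -(mulmxA _ P _) PP !mulmx1.
by rewrite -(mulmxA _ F B') FB mulmxN mulNmx !mulmxA.
Qed.

End DiagonalConjugation.

(** * The exponential of [i] times a Hermitian matrix *)

Section Exponential.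
Context {R : realType}.
Local Notation CC := (R[i] : numFieldType).

Definition expi (t : R) : R[i] := cos t +i* sin t.

Lemma expiDpi (t : R) : expi (t + pi) = - expi t.
Proof. by rewrite /expi cosDpi sinDpi. Qed.

Lemma expiBpi (t : R) : expi (t - pi) = - expi t.
Proof. by rewrite -[in RHS](subrK pi t) expiDpi opprK. Qed.

Lemma expi_unit (t : R) : (expi t)^*%R * expi t = 1.
Proof.
apply/eqP; rewrite eq_complex /=; apply/andP; split; apply/eqP; last by ring.
by rewrite -[RHS](cos2Dsin2 t); ring.
Qed.

Lemma cvg_real_complex (f : nat -> R) (l : R) : (f @ \oo --> l)%classic ->
  ((fun m => (f m)%:C : CC) @ \oo --> (l%:C : CC))%classic.
Proof.
move=> fl; apply/cvgrPdist_lt => e e0.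
have eE : e = (complex.Re e)%:C by rewrite RRe_real // gtr0_real.
have e0' : 0 < complex.Re e by rewrite -ltcR -eE.
move/cvgrPdist_lt : fl => /(_ _ e0'); apply: filterS => m h.
rewrite -rmorphB eE; move: h.
rewrite -ltcR; congr (_ < _).
by rewrite normc_def /= expr0n addr0 sqrtr_sqr.
Qed.

Lemma nat_ind_step2 (P : nat -> Prop) : P 0%N -> P 1%N -> (forall k, P k -> P k.+2) ->
  forall k, P k.
Proof. by move=> p0 p1 pS k; suff [] : P k /\ P k.+1 by []; elim: k => // k [] *; split; auto. Qed.

Lemma expi_coeff (t : R) k :
  (k`!%:R)^-1 * ('i * t%:C) ^+ k = cos_coeff t k +i* sin_coeff t k.
Proof.
suff h : ('i : R[i]) ^+ k =
    ((~~ odd k)%:R * (-1) ^+ k./2) +i* ((odd k)%:R * (-1) ^+ k.-1./2).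
  rewrite exprMn h.
  have -> : cos_coeff t k = (~~ odd k)%:R * (-1) ^+ k./2 * t ^+ k / k`!%:R by [].
  have -> : sin_coeff t k = (odd k)%:R * (-1) ^+ k.-1./2 * t ^+ k / k`!%:R by [].
  have -> : (k`!%:R : R[i])^-1 = (k`!%:R^-1)%:C by rewrite fmorphV /= rmorph_nat.
  rewrite -rmorphXn /=; apply/eqP; rewrite eq_complex /= !(mul0r, mulr0, subr0, addr0, add0r).
  by apply/andP; split; apply/eqP; ring.
(* Steps of two match ['i ^+ 2 = -1]. The truncated [k.-1] at [k = 0] is harmless, its term carrying
   the factor [odd 0]. *)
move: k; apply: nat_ind_step2.
- by rewrite expr0 /= !expr0 !mulr1.
- by rewrite expr1 /= !expr0 !mulr1 -complexiE.
move=> k ih; rewrite -addn2 exprD ih sqrCi addn2.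
case: k {ih} => [|k] /=; rewrite ?exprS; apply/eqP; rewrite eq_complex /= ?negbK;
  by apply/andP; split; apply/eqP; ring.
Qed.

Lemma cvg_expi (t : R) :
  ((fun m => \sum_(k < m) (k`!%:R)^-1 * ('i * t%:C) ^+ k : CC) @ \oo --> (expi t : CC))%classic.
Proof.
have -> : (fun m => \sum_(k < m) (k`!%:R)^-1 * ('i * t%:C) ^+ k) =
   (fun m => (series (cos_coeff t) m)%:C + 'i * (series (sin_coeff t) m)%:C).
  apply/funext => m; rewrite /series /= !big_mkord !rmorph_sum mulr_sumr -big_split.
  apply: eq_bigr => k _; rewrite expi_coeff -complexiE.
  by rewrite [LHS]complexE.
have -> : expi t = (cos t)%:C + 'i * (sin t)%:C by rewrite -complexiE [LHS]complexE.
apply: cvgD; first by apply: cvg_real_complex; rewrite cos.unlock; apply: is_cvg_series_cos_coeff.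
apply: cvgM; first exact: cvg_cst.
by apply: cvg_real_complex; rewrite sin.unlock; apply: is_cvg_series_sin_coeff.
Qed.

(** Closeness of matrices is tested entry by entry, and finitely many eventual conditions hold
    together eventually. *)
Lemma cvg_mx_coord (K : numFieldType) n (f : nat -> 'M[K]_n) (M : 'M[K]_n) :
  (forall i j, ((fun m => f m i j) @ \oo --> M i j)%classic) -> (f @ \oo --> M)%classic.
Proof.
move=> h; apply/cvg_mx_entourageP => A entA.
have FF : Filter (nbhs (\oo : set_system nat)%classic) by exact: eventually_filter.
apply: (@filter_forall nat 'I_n (fun i m => forall j, (M i j, f m i j) \in A) _ FF _) => i.
apply: (@filter_forall nat 'I_n (fun j m => (M i j, f m i j) \in A) _ FF _) => j.
have := h i j; move/cvg_entourageP => /(_ A entA).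
by apply: (@filterS _ _ FF) => m /=; rewrite inE.
Qed.

Lemma cvg_sum_seq (K : numFieldType) (I : Type) (s : seq I) (f : I -> nat -> K) (l : I -> K) :
  (forall i, (f i @ \oo --> l i)%classic) ->
  ((fun m => \sum_(i <- s) f i m) @ \oo --> \sum_(i <- s) l i)%classic.
Proof.
move=> h; elim: s => [|a s ih].
  rewrite big_nil; under eq_fun do rewrite big_nil; exact: cvg_cst.
rewrite big_cons; under eq_fun do rewrite big_cons.
exact: cvgD.
Qed.

(** All partial sums are diagonal in the same basis, so each entry is a finite combination of scalar
    exponential series. *)
Lemma expmx_unitary_diag n (P : 'M[R[i]]_n) (l : 'I_n -> R) (t : R) : P \is unitarymx ->
  expmx (('i * t%:C) *: (P^t* *m diag_mx (\row_j (l j)%:C) *m P)) =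
  P^t* *m diag_mx (\row_j expi (t * l j)) *m P.
Proof.
move=> uP; have PP : P *m P^t* = 1%:M by apply/unitarymxP.
rewrite /expmx; apply: cvg_lim; first exact: norm_hausdorff.
apply: cvg_mx_coord => a b.
pose F j m := (P^t*) a j * (\sum_(k < m) (k`!%:R)^-1 * ('i * (t * l j)%:C) ^+ k) * P j b.
have -> : (fun m => (\sum_(k < m) (k`!%:R)^-1 *: (('i * t%:C) *:
    (P^t* *m diag_mx (\row_j (l j)%:C) *m P)) ^+ k) a b) = (fun m => \sum_j F j m).
  apply/funext => m; rewrite summxE.
  under eq_bigr do rewrite unitary_conjmx_diag_pow// mxE mul_mx_diag mxE mulr_sumr.
  rewrite exchange_big; apply: eq_bigr => j _; rewrite /F mulr_sumr mulr_suml.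
  by apply: eq_bigr => k _; rewrite !mxE [(t * _)%:C]rmorphM !exprMn; ring.
rewrite mul_mx_diag mxE; apply: cvg_sum_seq => j; rewrite /F !mxE.
apply: cvgM; last exact: cvg_cst.
apply: cvgM; first exact: cvg_cst.
exact: cvg_expi.
Qed.

Lemma hermitian_diag n (A : 'M[R[i]]_n) : A \is hermsymmx ->
  exists (P : 'M[R[i]]_n) (l : 'I_n -> R),
    P \is unitarymx /\ A = P^t* *m diag_mx (\row_j (l j)%:C) *m P.
Proof.
move=> hA; have uP := spectral_unitarymx A.
exists (spectralmx A), (fun j => complex.Re (spectral_diag A ord0 j)); split=> //.
have -> : \row_j (complex.Re (spectral_diag A ord0 j))%:C = spectral_diag A.
  apply/rowP => j; rewrite mxE RRe_real //.
  by have /mxOverP := hermitian_spectral_diag_real hA; apply.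
by have /orthomx_spectralP := hermitian_normalmx hA; rewrite invmx_unitary.
Qed.

(* The eigenvalues of [A] that [B] connects differ by [sqrt g], so that the
   phases of [U] at these eigenvalues are opposite. *)
Lemma expmx_rotation n (A B : 'M[R[i]]_n) (g : R) : 0 < g -> A \is hermsymmx ->
  commutator A (commutator A B) = g%:C *: B ->
  let U := expmx (('i * (pi / Num.sqrt g)%:C) *: A) in
  [/\ U^t* *m U = 1%:M, U *m A = A *m U & U *m B = - (B *m U)].
Proof.
move=> g0 hA hB; have [P [l [uP AE]]] := hermitian_diag hA.
clear hA; subst A; rewrite /= (expmx_unitary_diag l _ uP).
apply: (unitary_conjmx_diag_anticomm uP hB) => [i j|i]; rewrite !mxE; last exact: expi_unit.
have sg : 0 < Num.sqrt g by rewrite sqrtr_gt0.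
have pis : pi / Num.sqrt g * Num.sqrt g = pi by rewrite divfK ?gt_eqF.
rewrite -rmorphB -rmorphXn => /complexI.
rewrite -[RHS]sqr_sqrtr ?ltW// => /eqP; rewrite eqf_sqr.
case/orP => /eqP h.
  have -> : l i = l j + Num.sqrt g by lra.
  by rewrite mulrDr pis expiDpi.
have -> : l i = l j - Num.sqrt g by lra.
by rewrite mulrBr pis expiBpi.
Qed.

End Exponential.

(** * Algebra of the raising and lowering operators *)

Section Ladder.
Context {K : numClosedFieldType} {n : nat}.
Implicit Types (A B C T : 'M[K]_n) (u v Phi : 'cV[K]_n) (g : K).

(* [B ^+ k *m v]; a separate constant, because matching modulo the unfolding of
   [^+] is slow. *)
Definition pw B k v : 'cV[K]_n := iter k (mulmx B) v.

Lemma pwE B k v : B ^+ k *m v = pw B k v.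
Proof. by elim: k => [|k ih]; rewrite ?expr0 ?mul1mx // exprS -mulmxA ih. Qed.

Lemma pwS B k v : pw B k.+1 v = B *m pw B k v.
Proof. by []. Qed.

Lemma pwSr B k v : pw B k.+1 v = pw B k (B *m v).
Proof. exact: iterSr. Qed.

Lemma pw0 B v : pw B 0 v = v.
Proof. by []. Qed.

Lemma pwD B k u v : pw B k (u + v) = pw B k u + pw B k v.
Proof. by elim: k => // k ih; rewrite !pwS ih mulmxDr. Qed.

Lemma pwB B k u v : pw B k (u - v) = pw B k u - pw B k v.
Proof. by elim: k => // k ih; rewrite !pwS ih mulmxBr. Qed.

Lemma pwZ B k z v : pw B k (z *: v) = z *: pw B k v.
Proof. by elim: k => // k ih; rewrite !pwS ih -scalemxAr. Qed.

Lemma pw_comm B T k v : T *m B = B *m T -> T *m pw B k v = pw B k (T *m v).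
Proof. by move=> TB; elim: k => // k ih; rewrite !pwS mulmxA TB -mulmxA ih. Qed.

(* [A] and [B] are the raising and lowering operators of a representation of
   su(2) with weight operator [C]; [T = (A B + B A) / 2 + g C^2] is its Casimir
   operator. *)
Definition ladder A B C T g := [/\ A^t* = B, T^t* = T, T *m A = A *m T /\ T *m B = B *m T,
  C *m A = A *m C + A /\ C *m B = B *m C - B &
  B *m A = T - g *: (C *m C + C) /\ A *m B = T - g *: (C *m C - C)].

(** Reflection of the weights; it turns statements about [A] into statements about [B]. *)
Lemma ladder_sym A B C T g : ladder A B C T g -> ladder B A (- C) T g.
Proof.
case=> [AB TT [TA TB] [CA CB] [BA AB']]; split => //.
- by rewrite -AB trmxCK.
- split; rewrite !mulNmx mulmxN ?CA ?CB; first by rewrite opprB addrC.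
  by rewrite opprD.
by rewrite mulmxN mulNmx !opprK.
Qed.

(** The action of [B A] on vectors of weight [k], where [C^2 + C] is [k (k + 1)]. *)
Definition casimir_shift T g k v := T *m v - (g * (k * k.+1)%:R) *: v.

Lemma casimir_shift_pow B T g k j v : T *m B = B *m T ->
  pw B j (casimir_shift T g k v) = casimir_shift T g k (pw B j v).
Proof. by move=> TB; rewrite /casimir_shift pwB pwZ (pw_comm _ _ TB). Qed.

Lemma ladder_weight A B C T g Phi k : ladder A B C T g -> C *m Phi = 0 ->
  C *m pw A k Phi = k%:R *: pw A k Phi.
Proof.
case=> [_ _ _ [CA _] _] CP; elim: k => [|k ih]; first by rewrite pw0 CP scale0r.
by rewrite pwS mulmxA CA mulmxDl -mulmxA ih -scalemxAr -{2}[A *m _]scale1r -scalerDl -natr1.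
Qed.

Lemma ladder_step A B C T g Phi k : ladder A B C T g -> C *m Phi = 0 ->
  B *m pw A k.+1 Phi = casimir_shift T g k (pw A k Phi).
Proof.
move=> lad CP; have CAk := ladder_weight k lad CP.
case: lad => [_ _ _ _ [BA _]].
rewrite pwS mulmxA BA mulmxBl -scalemxAl mulmxDl -mulmxA CAk -scalemxAr CAk.
rewrite scalerA -scalerDl scalerA; congr (_ - _ *: _).
by rewrite addrC -natrM -natrD -mulnS.
Qed.

(** Both sides are the product of the operators [T - g j (j + 1)], [j < k], applied to [Phi]. *)
Lemma ladder_pow A B C T g Phi k : ladder A B C T g -> C *m Phi = 0 ->
  pw A k (pw B k Phi) = pw B k (pw A k Phi).
Proof.
move=> lad CP; have ladS := ladder_sym lad.
have CP' : - C *m Phi = 0 by rewrite mulNmx CP oppr0.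
case: (lad) => [_ _ [TA TB] _ _].
elim: k => [|k ih]; first by rewrite !pw0.
rewrite !(pwSr _ _ (pw _ _ _)) (ladder_step _ lad CP) (ladder_step _ ladS CP').
by rewrite !casimir_shift_pow// ih.
Qed.

(** Let [L k = T - g k (k + 1)]. In the induction step the first product gains the factor [L k] and
    the second [L k.+1]; these differ by the scalar [2 g (k + 1)]. *)
Lemma ladder_pow_diff A B C T g Phi k : ladder A B C T g -> C *m Phi = 0 ->
  pw B k.+1 (pw A k Phi) - pw A k (pw B k.+1 Phi)
    = (g * (k * k.+1)%:R) *: pw A k.-1 (pw B k Phi).
Proof.
move=> lad CP; have ladS := ladder_sym lad.
have CP' : - C *m Phi = 0 by rewrite mulNmx CP oppr0.
case: (lad) => [_ _ [TA TB] _ _].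
elim: k => [|k ih]; first by rewrite !pw0 mul0n mulr0 scale0r subrr.
rewrite (pwSr B k.+1) (ladder_step _ lad CP) casimir_shift_pow//.
rewrite (pwSr A k) (ladder_step _ ladS CP') casimir_shift_pow// -[k.+1.-1]/k.
move/eqP: ih; rewrite subr_eq => /eqP ->.
set y := pw A k (pw B k.+1 Phi); set x := pw A k.-1 _.
(* For [k > 0] the shifted Casimir operator maps [x] to [y]; for [k = 0] the predecessor is
   truncated, but the coefficient is 0. *)
have Lx : (g * (k * k.+1)%:R) *: casimir_shift T g k x = (g * (k * k.+1)%:R) *: y.
  case: k @x @y => [|k] x y; first by rewrite mul0n mulr0 !scale0r.
  by rewrite /x -casimir_shift_pow// -(ladder_step _ ladS CP') -pwSr.
rewrite /casimir_shift in Lx *.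
rewrite mulmxDr scalerDr -scalemxAr [- (_ + _)]opprD addrACA -scalerBr Lx.
by rewrite addrC subrK opprB addrC subrK.
Qed.

End Ladder.

(** * Growth of the norms of [A^k Phi] *)

Section LadderGrowth.
Context {R : realType} {n : nat}.
Implicit Types (A B C T : 'M[R[i]]_n) (u v Phi : 'cV[R[i]]_n) (g : R).

(** The recursions give [b k.+1 * a k - b k * a k.+1 = a k * d k - b k ^+ 2 >= 0], so [b / a] does
    not decrease. The margin [e] keeps [a k.+1 >= e * a k] positive. *)
Lemma ratio_growth (a b c d : nat -> R) (e b0 : R) m :
  (forall k, a k.+1 = b k - c k * a k) -> (forall k, b k.+1 = d k - c k * b k) ->
  (forall k, b k ^+ 2 <= a k * d k) -> a 0%N = 1 -> b0 <= b 0%N -> 0 < e ->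
  (forall k, (k < m)%N -> e + c k <= b0) ->
  forall k, (k <= m)%N -> 0 < a k /\ b0 * a k <= b k.
Proof.
move=> aS bS b2 a0 hb e0 hc; elim=> [|k ih] km; first by rewrite a0 mulr1.
have [ak bk] := ih (ltnW km); have ck := hc _ km.
have a1 : 0 < a k.+1 by rewrite aS; nra.
split=> //; rewrite -(ler_pM2r ak); apply: (@le_trans _ _ (b k * a k.+1)).
  by rewrite mulrAC ler_wpM2r // ltW.
by rewrite aS bS; have := b2 k; lra.
Qed.

(* By Cauchy-Schwarz the Rayleigh quotients of [T] at the vectors [A^k Phi] are
   nondecreasing in [k]. *)
Lemma ladder_growth A B C T g Phi (q b : R) m : ladder A B C T g%:C -> C *m Phi = 0 ->
  0 < q -> hnorm Phi = 1 -> b <= complex.Re (inner Phi (T *m Phi)) ->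
  (forall k, (k < m)%N -> q ^+ 2 + g * (k * k.+1)%:R <= b) ->
  forall k, (k <= m)%N -> 0 < hnorm (pw A k Phi) /\
    ((k < m)%N -> q * hnorm (pw A k Phi) <= hnorm (pw A k.+1 Phi)).
Proof.
move=> lad CP q0 P1 hb hq; have [AB TT [TA TB] _ _] := lad.
pose v k := pw A k Phi.
pose a k := hnorm (v k) ^+ 2; pose be k := complex.Re (inner (v k) (T *m v k)).
pose c k : R := g * (k * k.+1)%:R.
have cE k : g%:C * (k * k.+1)%:R = (c k)%:C.
  by rewrite /c [RHS]rmorphM /= rmorph_nat.
(* [|A v|^2 = (v, B A v)], and [B A] acts on [v k] as [T - c k]. *)
have aS k : a k.+1 = be k - c k * a k.
  apply: (@complexI R); rewrite -inner_hnorm /v pwS inner_adj AB -pwS.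
  rewrite (ladder_step _ lad CP) /casimir_shift innerBr innerZr inner_hnorm.
  rewrite cE -/(v k) -/(a k) [RHS]rmorphB /= [(c k * _)%:C]rmorphM /= /be RRe_real //.
  by apply/CrealP; rewrite -innerC inner_adj TT.
have beS k : be k.+1 = hnorm (T *m v k) ^+ 2 - c k * be k.
  rewrite /be {1}/v pwS inner_adj AB mulmxA -TB -mulmxA /v (ladder_step _ lad CP) -/(v k).
  rewrite /casimir_shift mulmxBr -scalemxAr innerBr innerZr cE.
  have -> : inner (v k) (T *m (T *m v k)) = inner (T *m v k) (T *m v k) by rewrite inner_adj TT.
  rewrite inner_hnorm; set z := inner _ _; case: z => x y /=; ring.
have be2 k : be k ^+ 2 <= a k * hnorm (T *m v k) ^+ 2.
  rewrite -exprMn -[be k ^+ 2]real_normK ?num_real// ler_pXn2r ?nnegrE ?mulr_ge0 ?hnorm_ge0//.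
  exact: le_trans (Re_le_cmod _) (cauchy_schwarz _ _).
have a0 : a 0%N = 1 by rewrite /a /v pw0 P1 expr1n.
have b0 : b <= be 0%N by rewrite /be /v pw0.
have main := ratio_growth aS beS be2 a0 b0 (exprn_gt0 2 q0) hq.
move=> k km; have [ak bk] := main k km.
have hE : hnorm (pw A k Phi) ^+ 2 = a k := erefl.
have hE1 : hnorm (pw A k.+1 Phi) ^+ 2 = a k.+1 := erefl.
have h0 := hnorm_ge0 (pw A k Phi); have h1 := hnorm_ge0 (pw A k.+1 Phi).
move: (hnorm _) (hnorm (pw A k.+1 _)) h0 h1 hE hE1 => x y x0 y0 xE yE.
have := aS k; have hck : (k < m)%N -> q ^+ 2 + c k <= b := hq k.
move: (a k) (a k.+1) (be k) (c k) ak bk xE yE hck => ak ak1 bk ck ak0 bk0 xE yE hck aE.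
split; first by rewrite lt_neqAle x0 andbT eq_sym -sqrf_eq0 xE gt_eqF.
move=> km'; rewrite -(@ler_pXn2r _ 2) ?nnegrE ?mulr_ge0 ?(ltW q0)//.
by rewrite exprMn xE yE aE; have := hck km'; nra.
Qed.

End LadderGrowth.

(** * Moving powers of ladder operators across a local operator *)

Section Reordering.
Context {R : realType} {n : nat}.
Implicit Types (A B C T X : 'M[R[i]]_n) (u v w Phi : 'cV[R[i]]_n) (g : R).

Lemma inner_pow B B' k u v : B^t* = B' -> inner u (pw B k v) = inner (pw B' k u) v.
Proof.
move=> BB'; elim: k u => [|k ih] u; first by rewrite !pw0.
by rewrite pwS inner_adjr BB' ih -pwSr.
Qed.

(** [loc c X] stands for a class of local operators [X] with bound [c]; only its behaviour under
    commutators with [B] matters for reordering. *)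
Definition commutator_stable (loc : R -> 'M[R[i]]_n -> Prop) (beta : R) B :=
  forall c X, loc c X ->
    [/\ 0 <= c, op_bounded c X & loc (beta * c) (commutator X B)].

Section Moves.
Variables (loc : R -> 'M[R[i]]_n -> Prop) (B B' : 'M[R[i]]_n) (Phi w : 'cV[R[i]]_n).
Variables (t q : R) (a : nat -> R) (m : nat).
Hypothesis adjB : B^t* = B'.
Hypothesis locB : commutator_stable loc (t * q) B.
Hypothesis t0 : 0 <= t.
Hypothesis le_a : forall k, hnorm (pw B' k Phi) <= a k.
Hypothesis growth : forall k, (k < m)%N -> q * a k <= a k.+1.

(** A commutator costs [t * q], and the factor [B] that it absorbs is worth [1 / q] by [growth]: the
    net cost is [t]. *)
Lemma growth_scaled k (c x y : R) : (k < m)%N -> 0 <= c -> 0 <= x -> 0 <= y ->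
  t * q * c * x * a k * y <= c * x * t * a k.+1 * y.
Proof.
move=> km c0 x0 y0; rewrite ler_wpM2r //.
have -> : t * q * c * x * a k = c * x * t * (q * a k) by ring.
by rewrite ler_wpM2l ?growth ?mulr_ge0.
Qed.

Lemma swap_step X i j : inner Phi (pw B i (X *m (pw B j.+1 w))) =
  inner Phi (pw B i.+1 (X *m (pw B j w))) +
  inner Phi (pw B i (commutator X B *m (pw B j w))).
Proof.
rewrite -innerDr (pwSr B i) -pwD /commutator mulmxBl -!mulmxA.
by rewrite addrC subrK.
Qed.

(** Each of the [j] factors either passes [X], with weight 1, or is absorbed in a commutator, with
    weight [t]. The factors on the left act on [Phi] as powers of the adjoint [B']. *)
Lemma swap_bound c X i j : loc c X -> (i + j <= m)%N ->
  cmod (inner Phi (pw B i (X *m (pw B j w)))) <=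
  c * (1 + t) ^+ j * a (i + j) * hnorm w.
Proof.
elim: j i c X => [|j ih] i c X lX ijm.
  rewrite pw0 expr0 mulr1 addn0 (inner_pow _ _ _ adjB).
  have [c0 hX _] := locB lX; apply: le_trans (hX _ _) _.
  by rewrite ler_wpM2r ?hnorm_ge0 ?ler_wpM2l.
have [c0 _ lX'] := locB lX; rewrite addnS in ijm *.
rewrite swap_step; apply: le_trans (cmodD _ _) _.
have h1 := ih i.+1 c X lX; rewrite addSn in h1.
have h2 := ih i _ _ lX' (ltnW ijm).
have p0 : 0 <= (1 + t) ^+ j by rewrite exprn_ge0 ?addr_ge0.
have h3 := growth_scaled ijm c0 p0 (hnorm_ge0 w).
apply: le_trans (lerD (h1 ijm) (le_trans h2 h3)) _.
rewrite exprS -mulrDl ler_wpM2r ?hnorm_ge0 // -mulrDl ler_wpM2r //.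
  exact: le_trans (hnorm_ge0 _) (le_a _).
by rewrite le_eqVlt; apply/orP; left; apply/eqP; ring.
Qed.

(** The same recursion without the commutator-free term, which accounts for the 1 in the expansion
    of [(1 + t) ^+ j]. *)
Lemma swap_first_order c X i j : loc c X -> (i + j <= m)%N ->
  cmod (inner Phi (pw B i (X *m (pw B j w))) -
        inner Phi (pw B (i + j) (X *m w))) <=
  c * ((1 + t) ^+ j - 1) * a (i + j) * hnorm w.
Proof.
elim: j i c X => [|j ih] i c X lX ijm.
  by rewrite pw0 addn0 subrr expr0 subrr mulr0 !mul0r /cmod normr0.
have [c0 _ lX'] := locB lX; rewrite addnS in ijm *.
rewrite swap_step addrAC; apply: le_trans (cmodD _ _) _.
have h1 := ih i.+1 c X lX; rewrite addSn in h1.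
have h2 := swap_bound lX' (ltnW ijm).
have p0 : 0 <= (1 + t) ^+ j by rewrite exprn_ge0 ?addr_ge0.
have h3 := growth_scaled ijm c0 p0 (hnorm_ge0 w).
apply: le_trans (lerD (h1 ijm) (le_trans h2 h3)) _.
rewrite exprS -mulrDl ler_wpM2r ?hnorm_ge0 // -mulrDl ler_wpM2r //.
  exact: le_trans (hnorm_ge0 _) (le_a _).
by rewrite le_eqVlt; apply/orP; left; apply/eqP; ring.
Qed.

(** The [j] terms with a single commutator are removed as well, after moving their other factors to
    the left; the rest is of order [t^2]. If [i + j = 0], the truncated power has coefficient 0. *)
Lemma swap_second_order c X i j : loc c X -> (i + j <= m)%N ->
  cmod (inner Phi (pw B i (X *m (pw B j w))) -
        inner Phi (pw B (i + j) (X *m w)) -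
        j%:R * inner Phi (pw B (i + j).-1 (commutator X B *m w))) <=
  c * ((1 + t) ^+ j - 1 - j%:R * t) * a (i + j) * hnorm w.
Proof.
elim: j i c X => [|j ih] i c X lX ijm.
  by rewrite pw0 addn0 subrr expr0 !mul0r !subrr mulr0 !mul0r /cmod normr0.
have [c0 _ lX'] := locB lX; rewrite addnS in ijm *.
have h1 := ih i.+1 c X lX; rewrite addSn /= in h1 *.
have h2 := swap_first_order lX' (ltnW ijm).
rewrite swap_step.
set x := inner _ _ in h1 *; set y := inner _ _ in h1 *; set z := inner _ _ in h1 *.
set x' := inner _ _ in h2 *.
(* The second-order error for [X] plus the first-order error for its commutator. *)
have -> : x + x' - y - j.+1%:R * z = (x - y - j%:R * z) + (x' - z).
  by rewrite -natr1; ring.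
apply: le_trans (cmodD _ _) _.
have p0 : 0 <= (1 + t) ^+ j - 1 by rewrite subr_ge0 exprn_ege1 // lerDl.
have h3 := growth_scaled ijm c0 p0 (hnorm_ge0 w).
apply: le_trans (lerD (h1 ijm) (le_trans h2 h3)) _.
rewrite exprS -natr1 -mulrDl ler_wpM2r ?hnorm_ge0 // -mulrDl ler_wpM2r //.
  exact: le_trans (hnorm_ge0 _) (le_a _).
by rewrite le_eqVlt; apply/orP; left; apply/eqP; ring.
Qed.

End Moves.

(** [|B^k Phi|^2 = (Phi, A^k B^k Phi)], and the two powers can be exchanged on [Phi]. *)
Lemma ladder_hnorm A B C T g Phi k : ladder A B C T g%:C -> C *m Phi = 0 ->
  hnorm (pw B k Phi) = hnorm (pw A k Phi).
Proof.
move=> lad CP; have [AB _ _ _ _] := lad.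
have BA : B^t* = A by rewrite -AB trmxCK.
rewrite /hnorm -(inner_pow _ _ _ AB) (ladder_pow _ lad CP).
by rewrite (inner_pow _ _ _ BA).
Qed.

Lemma commutator_adj X A : (commutator X A)^t* = - commutator (X^t*) (A^t*).
Proof.
by rewrite /commutator [(_ - _)^T]raddfB /= map_mxB !trmx_mul !map_mxM opprB.
Qed.

(** In real parts the conjugation disappears, so the first-order terms add up to [b Re (Q2 - Q1)].
    Replacing each [Q] by its [P] leaves only [- b k Re D]. *)
Lemma Re_sum_bound (z1 z2 P1 P2 Q1 Q2 D : R[i]) (b e1 e2 f1 f2 h k : R) :
  0 <= b -> 0 <= k ->
  cmod (z1 - b%:C * - Q1^*%R) <= e1 -> cmod (z2 - b%:C * Q2) <= e2 ->
  cmod (P1 - Q1) <= f1 -> cmod (P2 - Q2) <= f2 ->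
  P1 - P2 = k%:C * D -> cmod D <= h ->
  `|complex.Re (z1 + z2)| <= e1 + e2 + b * (f1 + f2 + k * h).
Proof.
move=> b0 k0 /(le_trans (Re_le_cmod _)) h1 /(le_trans (Re_le_cmod _)) h2.
move=> /(le_trans (Re_le_cmod _)) h3 /(le_trans (Re_le_cmod _)) h4 PD.
move=> /(le_trans (Re_le_cmod _)) h5.
have {}PD : complex.Re P1 - complex.Re P2 = k * complex.Re D.
  have := congr1 (@complex.Re R) PD; case: (P1) (P2) (D) => [? ?] [? ?] [? ?] /=.
  by rewrite mul0r subr0.
have {h1} : `|complex.Re z1 + b * complex.Re Q1| <= e1.
  apply: le_trans h1; rewrite le_eqVlt; apply/orP; left; apply/eqP; congr `|_|.
  by case: (z1) (Q1) => [? ?] [? ?] /=; ring.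
have {h2} : `|complex.Re z2 - b * complex.Re Q2| <= e2.
  apply: le_trans h2; rewrite le_eqVlt; apply/orP; left; apply/eqP; congr `|_|.
  by case: (z2) (Q2) => [? ?] [? ?] /=; ring.
have {h3} : `|complex.Re P1 - complex.Re Q1| <= f1.
  by move: h3; case: (P1) (Q1) => [? ?] [? ?].
have {h4} : `|complex.Re P2 - complex.Re Q2| <= f2.
  by move: h4; case: (P2) (Q2) => [? ?] [? ?].
have -> : complex.Re (z1 + z2) = complex.Re z1 + complex.Re z2.
  by case: (z1) (z2) => [? ?] [? ?].
move: h5 PD; move: (complex.Re z1) (complex.Re z2) (complex.Re P1) (complex.Re P2).
move: (complex.Re Q1) (complex.Re Q2) (complex.Re D) => y1 y2 x x1 x2 p1 p2.
move=> hx hp hp2 hp1 h2 h1.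
have -> : x1 + x2 = (x1 + b * y1) + (x2 - b * y2) +
   b * ((p1 - y1) - (p2 - y2) - k * x) by rewrite -hp; ring.
apply: le_trans (ler_normD _ _) _; apply: lerD.
  by apply: le_trans (ler_normD _ _) _; rewrite lerD.
rewrite normrM (ger0_norm b0) ler_wpM2l //.
apply: le_trans (ler_normB _ _) _; rewrite normrM (ger0_norm k0) lerD ?ler_wpM2l//.
by apply: le_trans (ler_normB _ _) _; rewrite lerD.
Qed.

(** [V], [W], [Y] are the norms of [A^(m+1) Phi], [A^m Phi], [A^(m-1) Phi]; the growth bounds trade
    [Y] for [W / q] and [W] for [V / q], until only [V^2] is left. *)
Lemma energy_arith (c t q g V W Y : R) m :
  0 <= c -> 0 <= t -> 0 < q -> 0 <= g -> 0 <= V -> 0 <= W -> 0 <= Y ->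
  q * W <= V -> ((0 < m)%N -> q * Y <= W) ->
  c * ((1 + t) ^+ m.+1 - 1 - m.+1%:R * t) * V * V +
  c * ((1 + t) ^+ m.+1 - 1 - m.+1%:R * t) * V * V +
  m.+1%:R * (t * q * c * ((1 + t) ^+ m.+1 - 1) * V * W +
    t * q * c * ((1 + t) ^+ m - 1) * W * V +
    g * (m * m.+1)%:R * (t * q * c * (1 + t) ^+ m.-1 * Y * W)) <=
  c * (2 * ((1 + t) ^+ m.+1 - 1 - m.+1%:R * t) + m.+1%:R * (2 * (t * ((1 + t) ^+ m.+1 - 1)) +
       g * m.+1%:R ^+ 2 * (t * (1 + t) ^+ m.+1) / q ^+ 2)) * V ^+ 2.
Proof.
move=> c0 t0 q0 g0 V0 W0 Y0 VW WY.
have t1 : 1 <= 1 + t by rewrite lerDl.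
have p1 : (1 + t) ^+ m <= (1 + t) ^+ m.+1 by rewrite ler_weXn2l.
have p2 : (1 + t) ^+ m.-1 <= (1 + t) ^+ m.+1.
  by rewrite ler_weXn2l // (leq_trans (leq_pred _)).
have p3 : 1 <= (1 + t) ^+ m by rewrite exprn_ege1.
have p4 : 0 <= (1 + t) ^+ m.-1 by rewrite exprn_ge0 // addr_ge0.
have M0 : 0 <= m%:R :> R by [].
have MM : (m * m.+1)%:R = m%:R * m.+1%:R :> R by rewrite natrM.
have SM : m%:R <= m.+1%:R :> R by rewrite ler_nat.
(* For [m = 0] nothing bounds [Y], but the factor [m] vanishes. *)
have mY : m%:R * (q * Y) <= m.+1%:R * W.
  case: (posnP m) => [->|m0]; first by rewrite mul0r mulr_ge0.
  by apply: ler_pM; rewrite ?mulr_ge0 ?WY // ltW.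
have qW2 : W ^+ 2 <= V ^+ 2 / q ^+ 2.
  rewrite ler_pdivlMr ?exprn_gt0 // -exprMn mulrC.
  by rewrite ler_pXn2r ?nnegrE ?mulr_ge0 // ltW.
rewrite MM {MM}.
move: p1 p2 p3 p4 M0 SM mY.
move: ((1 + t) ^+ m.+1) ((1 + t) ^+ m) ((1 + t) ^+ m.-1) => x y z p1 p2 p3 p4.
move: (m.+1%:R) (m%:R) => M N M0 SM mY.
have MP : 0 <= M by exact: le_trans SM.
have h1 : t * q * c * (x - 1) * V * W <= c * (t * (x - 1)) * V ^+ 2.
  have -> : t * q * c * (x - 1) * V * W = c * (t * (x - 1)) * (V * (q * W)) by ring.
  rewrite ler_wpM2l ?expr2 ?ler_wpM2l // !mulr_ge0 // subr_ge0.
  exact: le_trans p1.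
have h2 : t * q * c * (y - 1) * W * V <= c * (t * (x - 1)) * V ^+ 2.
  apply: le_trans h1; have -> : t * q * c * (y - 1) * W * V = t * q * c * V * W * (y - 1) by ring.
  have -> : t * q * c * (x - 1) * V * W = t * q * c * V * W * (x - 1) by ring.
  by rewrite ler_wpM2l ?lerB // !mulr_ge0 // ltW.
have h3 : g * (N * M) * (t * q * c * z * Y * W) <=
    c * (g * M ^+ 2 * (t * x) / q ^+ 2) * V ^+ 2.
  have -> : g * (N * M) * (t * q * c * z * Y * W) = c * g * t * M * (z * ((N * (q * Y)) * W)) by ring.
  have -> : c * (g * M ^+ 2 * (t * x) / q ^+ 2) * V ^+ 2 =
     c * g * t * M * (x * (M * (V ^+ 2 / q ^+ 2))) by rewrite expr2; ring.
  rewrite ler_wpM2l ?mulr_ge0 //; apply: ler_pM => //.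
    by rewrite !mulr_ge0 // ?ltW // (le_trans _ SM).
  apply: (@le_trans _ _ (M * W * W)); first by rewrite ler_wpM2r.
  by rewrite -mulrA -expr2 ler_wpM2l.
set a := c * (x - 1 - M * t) * V * V.
apply: (@le_trans _ _ (a + a + M * (c * (t * (x - 1)) * V ^+ 2 +
   c * (t * (x - 1)) * V ^+ 2 + c * (g * M ^+ 2 * (t * x) / q ^+ 2) * V ^+ 2))).
  by rewrite lerD2l ler_wpM2l // lerD // lerD.
rewrite le_eqVlt; apply/orP; left; apply/eqP; rewrite /a; ring.
Qed.

(* Summed over the sites, the two differences become the energy shifts of
   [A^m Phi] and of [B^m Phi].  Each has a term of first order in
   [m]; the real parts of these cancel up to terms of second order. *)
Lemma ladder_local_energy (loc : R -> 'M[R[i]]_n -> Prop) A B C T g Phi (t q c : R) X m :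
  ladder A B C T g%:C -> C *m Phi = 0 -> 0 <= g ->
  commutator_stable loc (t * q) A -> commutator_stable loc (t * q) B ->
  0 <= t -> 0 < q ->
  (forall k, (k < m)%N -> q * hnorm (pw A k Phi) <= hnorm (pw A k.+1 Phi)) ->
  loc c X -> X^t* = X -> (0 < m)%N ->
  `|complex.Re
      (inner Phi (X *m (pw B m (pw A m Phi))) -
         inner Phi (pw B m (X *m (pw A m Phi))) +
       (inner Phi (X *m (pw A m (pw B m Phi))) -
         inner Phi (pw A m (X *m (pw B m Phi)))))| <=
  c * (2 * ((1 + t) ^+ m - 1 - m%:R * t) + m%:R * (2 * (t * ((1 + t) ^+ m - 1)) +
       g * m%:R ^+ 2 * (t * (1 + t) ^+ m) / q ^+ 2)) * hnorm (pw A m Phi) ^+ 2.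
Proof.
move=> lad CP g0 locA locB t0 q0 hgrow lX XX; case: m hgrow => [//|m] hgrow _.
have [AB _ _ _ _] := lad; have BA : B^t* = A by rewrite -AB trmxCK.
pose a k := hnorm (pw A k Phi).
have leA k : hnorm (pw A k Phi) <= a k by [].
have leB k : hnorm (pw B k Phi) <= a k by rewrite (ladder_hnorm k lad CP).
have [c0 _ lXA] := locA _ _ lX.
set v := (pw A m.+1 Phi); set u := (pw B m.+1 Phi).
have hZ1 := swap_second_order v BA locB t0 leA hgrow (i := 0) lX (leqnn m.+1).
have hZ2 := swap_second_order u AB locA t0 leB hgrow (i := 0) lX (leqnn m.+1).
(* Both first-order terms are compared with expressions having [[X, A]] leftmost; these differ only
   by the order of [B^(m+1)] and [A^m] on [Phi]. *)
have hQ1 := swap_first_order (pw A m Phi) BA locB t0 leA hgrow (i := 0) lXA (leqnn m.+1).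
have hQ2 := swap_first_order u AB locA t0 leB hgrow (i := 0) lXA (leqnSn m).
have hD := swap_bound (pw B m Phi) AB locA t0 leB hgrow (i := 0) (j := m.-1) lXA
  (leq_trans (leq_pred _) (leqnSn _)).
have diff := ladder_pow_diff m lad CP.
have PE : inner Phi (commutator X A *m (pw B m.+1 (pw A m Phi))) -
    inner Phi (commutator X A *m (pw A m u)) =
    (g%:C * (m * m.+1)%:R) * inner Phi (commutator X A *m (pw A m.-1 (pw B m Phi))).
  by rewrite -innerBr -mulmxBr diff -scalemxAr innerZr.
(* For self-adjoint [X], the adjoint of [[X, B]] is [- [X, A]]; this sign makes the two first-order
   terms nearly cancel in real part. *)
have q1E : inner Phi (pw B m (commutator X B *m v)) =
    - (inner Phi (pw B m.+1 (commutator X A *m (pw A m Phi))))^*%R.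
  rewrite !(inner_pow _ _ _ BA) -/v -innerC inner_adj commutator_adj XX AB.
  by rewrite mulNmx innerNr opprK.
rewrite !add0n !pw0 in hZ1 hZ2 hQ1 hQ2 hD; rewrite -pred_Sn q1E in hZ1; rewrite -pred_Sn in hZ2.
have MC : (m.+1%:R : R[i]) = (m.+1%:R)%:C by rewrite rmorph_nat.
rewrite MC in hZ1 hZ2.
have GC : g%:C * (m * m.+1)%:R = (g * (m * m.+1)%:R)%:C by rewrite [RHS]rmorphM /= rmorph_nat.
rewrite GC in PE.
have g1 : 0 <= g * (m * m.+1)%:R by rewrite mulr_ge0.
apply: le_trans (Re_sum_bound (ler0n _ _) g1 hZ1 hZ2 hQ1 hQ2 PE hD) _.
have V0 : 0 <= a m.+1 := hnorm_ge0 _; have W0 : 0 <= a m := hnorm_ge0 _.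
have Y0 : 0 <= a m.-1 := hnorm_ge0 _.
have VW : q * a m <= a m.+1 := hgrow m (ltnSn m).
have WY : (0 < m)%N -> q * a m.-1 <= a m.
  by move=> m0; have := hgrow m.-1; rewrite prednK // => /(_ (leqnSn m)).
have uV : hnorm u = a m.+1 by rewrite /u (ladder_hnorm _ lad CP).
have uW : hnorm (pw B m Phi) = a m by rewrite (ladder_hnorm _ lad CP).
rewrite uV uW -/(a m) -[hnorm v]/(a m.+1).
move: (a m.+1) (a m) (a m.-1) V0 W0 Y0 VW WY => V W Y V0 W0 Y0 VW WY.
clear -V0 W0 Y0 VW WY t0 q0 c0 g0.
exact: energy_arith.
Qed.

End Reordering.

(** * From the order operators to a ladder *)

Section SpinAlgebra.
Context {K : numClosedFieldType} {n : nat}.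
Implicit Types (X Y C : 'M[K]_n) (g z : K).

Lemma hermsymmx_adj X : X \is hermsymmx -> X^t* = X.
Proof. by move/is_hermitianmxP => {2}->; rewrite expr0 scale1r. Qed.

Lemma adj_add X Y : (X + Y)^t* = X^t* + Y^t*.
Proof. by rewrite raddfD /= map_mxD. Qed.

Lemma adj_scale z X : (z *: X)^t* = z^* *: X^t*.
Proof. by apply/matrixP => i j; rewrite !mxE rmorphM. Qed.

Lemma adj_mul X Y : (X *m Y)^t* = Y^t* *m X^t*.
Proof. by rewrite trmx_mul map_mxM. Qed.

Lemma commutatorE X Y : X *m Y = Y *m X + commutator X Y.
Proof. by rewrite /commutator addrC subrK. Qed.

Lemma spin_raising_weight (O1 O2 : 'M[K]_n) C :
  commutator O1 C = - ('i *: O2) -> commutator O2 C = 'i *: O1 ->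
  C *m (O1 + 'i *: O2) = (O1 + 'i *: O2) *m C + (O1 + 'i *: O2).
Proof.
move=> h1 h2; suff h : commutator (O1 + 'i *: O2) C = - (O1 + 'i *: O2).
  by rewrite (commutatorE _ C) h subrK.
rewrite /commutator mulmxDl mulmxDr -scalemxAl -scalemxAr opprD addrACA -scalerBr.
rewrite -/(commutator O1 C) -/(commutator O2 C) h1 h2 scalerA -expr2 sqrCi scaleN1r.
by rewrite opprD addrC.
Qed.

(** The root [z] is left open: ['i] gives [B A] and [- 'i] gives [A B]. *)
Lemma spin_lowering_raising (O1 O2 : 'M[K]_n) C z g : z ^+ 2 = -1 ->
  commutator O1 O2 = ('i * g) *: C ->
  (O1 - z *: O2) *m (O1 + z *: O2) =
  O1 *m O1 + O2 *m O2 + (z * 'i * g) *: C.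
Proof.
move=> z2 h; rewrite mulmxBl !mulmxDr -!scalemxAl -!scalemxAr scalerA -expr2 z2 scaleN1r.
rewrite opprD opprK -mulrA -scalerA -h scalerBr.
by rewrite [- _ + _]addrC addrACA.
Qed.

Lemma spin_ladder (O1 O2 : 'M[K]_n) C g : O1^t* = O1 -> O2^t* = O2 -> C^t* = C -> g^* = g ->
  commutator O1 C = - ('i *: O2) -> commutator O2 C = 'i *: O1 ->
  commutator O1 O2 = ('i * g) *: C ->
  ladder (O1 + 'i *: O2) (O1 - 'i *: O2) C (O1 *m O1 + O2 *m O2 + g *: (C *m C)) g.
Proof.
move=> a1 a2 aC ag h1 h2 h3.
have CA := spin_raising_weight h1 h2.
set A := O1 + 'i *: O2 in CA *; set B := O1 - _; set T := _ + g *: _.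
have AB : A^t* = B by rewrite adj_add adj_scale a1 a2 conjCi scaleNr.
have TT : T^t* = T by rewrite !adj_add adj_scale !adj_mul a1 a2 aC ag.
have BA : B *m A = T - g *: (C *m C + C).
  rewrite (spin_lowering_raising (sqrCi _) h3) -expr2 sqrCi mulN1r scaleNr.
  by rewrite /T scalerDr opprD addrA addrK.
have AB' : A *m B = T - g *: (C *m C - C).
  have := @spin_lowering_raising O1 O2 C (- 'i) g; rewrite scaleNr opprK => ->//; last first.
    by rewrite sqrrN sqrCi.
  rewrite mulNr mulNr -expr2 sqrCi mulN1r opprK /T scalerBr opprB.
  by rewrite [_ - g *: (C *m C)]addrC addrA addrK.
clearbody A B T.
have CB : C *m B = B *m C - B.
  have := congr1 (fun X => X^t*) CA; rewrite adj_add !adj_mul aC AB => ->.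
  by rewrite addrK.
(* Expressing [T] by [A B] on the left side and by [B A] on the right leaves
   [(C^2 - C) A = A (C^2 + C)], which follows from [C A = A (C + 1)]. *)
have TA : T *m A = A *m T.
  have T1 : T = A *m B + g *: (C *m C - C) by rewrite AB' subrK.
  have T2 : T = B *m A + g *: (C *m C + C) by rewrite BA subrK.
  rewrite {1}T1 T2 mulmxDl mulmxDr mulmxA -scalemxAl -scalemxAr; congr (_ + _ *: _).
  rewrite mulmxBl mulmxDr -mulmxA CA mulmxDr mulmxA CA mulmxDl.
  by rewrite addrK mulmxA.
split=> //; split=> //.
by have := congr1 (fun X => X^t*) TA; rewrite !adj_mul TT AB => ->.
Qed.

End SpinAlgebra.

(** * Local operators and their commutators with the ladder *)

Section Locality.
Context {R : realType} {L : finType} {n : nat}.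
Variables (o : axis -> L -> 'M[R[i]]_n) (ob : R) (r : nat).
Implicit Types (X Y : 'M[R[i]]_n) (S : {set L}).

Lemma op_bounded_le (c c' : R) X : c <= c' -> op_bounded c X -> op_bounded c' X.
Proof.
move=> cc hX u v; apply: le_trans (hX u v) _.
by rewrite ler_wpM2r ?hnorm_ge0 // ler_wpM2r ?hnorm_ge0.
Qed.

Lemma op_bounded_commutator (c c' : R) X Y : 0 <= c -> 0 <= c' ->
  op_bounded c X -> op_bounded c' Y -> op_bounded (2 * c * c') (commutator X Y).
Proof.
move=> c0 c0' hX hY; apply: op_bounded_le (_ : c * c' + c' * c <= _) _; first by nra.
apply: op_boundedD; first exact: op_boundedM.
by apply: op_boundedN; exact: op_boundedM.
Qed.

(** Support in the sense of commutation: the order operators outside [S] commute with [X]. *)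
Definition local S (c : R) X :=
  [/\ 0 <= c, op_bounded c X & forall y a, y \notin S -> commutator X (o a y) = 0].

Lemma commutator_sumr (F : L -> 'M[R[i]]_n) X :
  commutator X (\sum_x F x) = \sum_x commutator X (F x).
Proof. by rewrite /commutator mulmx_sumr mulmx_suml -sumrB. Qed.

Lemma commutator_combr (z : R[i]) X Y1 Y2 :
  commutator X Y1 = 0 -> commutator X Y2 = 0 -> commutator X (Y1 + z *: Y2) = 0.
Proof.
move=> h1 h2; rewrite /commutator mulmxDr mulmxDl -scalemxAr -scalemxAl.
by rewrite opprD addrACA -scalerBr -/(commutator X Y1) -/(commutator X Y2) h1 h2 scaler0 addr0.
Qed.

Lemma commutator_commutator X Y Z :
  commutator X Z = 0 -> commutator Y Z = 0 -> commutator (commutator X Y) Z = 0.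
Proof.
move=> /eqP; rewrite subr_eq0 => /eqP XZ /eqP; rewrite subr_eq0 => /eqP YZ.
apply/eqP; rewrite subr_eq0; apply/eqP.
by rewrite /commutator mulmxBl mulmxBr -!mulmxA YZ XZ !mulmxA XZ YZ.
Qed.

(** Only sites of [S] contribute: at most [r] commutators, each bounded by [2 * c * (2 * ob)]. The
    support does not grow, since order operators at distinct sites commute. *)
Lemma local_commutator_stable S (z : R[i]) : cmod z = 1 -> 0 <= ob ->
  (forall a x, op_bounded ob (o a x)) -> (#|S| <= r)%N ->
  (forall x y a b, x != y -> commutator (o a x) (o b y) = 0) ->
  commutator_stable (local S) (4 * r%:R * ob)
    (\sum_x o axis1 x + z *: \sum_x o axis2 x).
Proof.
move=> z1 ob0 hob Sr hcomm c X [c0 hX lX]; split=> //.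
pose b x := o axis1 x + z *: o axis2 x.
have bB x : op_bounded (2 * ob) (b x).
  rewrite mulr_natl mulr2n; apply: op_boundedD => //.
  by rewrite -[ob]mul1r -z1; apply: op_boundedZ.
have comE : commutator X (\sum_x o axis1 x + z *: \sum_x o axis2 x) =
    \sum_(x in S) commutator X (b x).
  rewrite scaler_sumr -big_split commutator_sumr [LHS](bigID (mem S)) /= [X in _ + X]big1 ?addr0 //.
  by move=> x xS; apply: commutator_combr; apply: lX.
rewrite comE; split.
- by rewrite !mulr_ge0.
- apply: op_bounded_le (_ : #|S|%:R * (2 * c * (2 * ob)) <= _) _.
    have -> : 4 * r%:R * ob * c = r%:R * (2 * c * (2 * ob)) by ring.
    by rewrite ler_wpM2r ?ler_nat // !mulr_ge0.
  by apply: op_bounded_sum => x; apply: op_bounded_commutator => //; rewrite mulr_ge0.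
move=> y a yS; rewrite /commutator mulmx_suml mulmx_sumr -sumrB big1 // => x xS.
have xy : x != y by apply: contraNneq yS => <-.
apply: commutator_commutator; first exact: lX.
apply/eqP; rewrite subr_eq0 mulmxDl mulmxDr -scalemxAl -scalemxAr; apply/eqP.
by rewrite !(commutatorE _ (o a y)) !hcomm // !addr0.
Qed.

End Locality.

(** * Elementary estimates of the constants *)

Section Numeric.
Context {R : realType}.

Lemma exp_quadratic_bound (t : R) k : 0 <= t -> k%:R * t <= 1 ->
  (1 + t) ^+ k <= 1 + k%:R * t + (k%:R * t) ^+ 2.
Proof.
move=> t0; elim: k => [|k ih] kt; first by rewrite expr0 mul0r expr0n /= !addr0.
have kt' : k%:R * t <= 1 by apply: le_trans kt; rewrite ler_wpM2r // ler_nat.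
have {ih} := ih kt'; rewrite (exprS _ k) -natr1; have k0 : 0 <= k%:R :> R by [].
move: (k%:R) ((1 + t) ^+ k) k0 kt' => x p x0 xt hp.
apply: (@le_trans _ _ ((1 + t) * (1 + x * t + (x * t) ^+ 2))).
  by rewrite ler_wpM2l // addr_ge0.
(* With [y = x * t <= 1], the induction step amounts to [y^2 t <= y t + t^2]. *)
have : x * t * (x * t) * t <= x * t * t.
  by rewrite ler_wpM2r // -[leRHS]mulr1 ler_wpM2l // mulr_ge0.
have := sqr_ge0 t; nra.
Qed.

(** With [y = m t <= 1] the power is at most [1 + y + y^2 <= 3]; the three terms are then at most
    [2 y^2], [4 y^2] and [3 g m^2 / q^2]. *)
Lemma energy_constant_bound (g t q : R) m : 0 <= g -> 0 <= t -> 0 < q -> m%:R * t <= 1 ->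
  2 * ((1 + t) ^+ m - 1 - m%:R * t) + m%:R * (2 * (t * ((1 + t) ^+ m - 1)) +
       g * m%:R ^+ 2 * (t * (1 + t) ^+ m) / q ^+ 2) <=
  6 * (m%:R * t) ^+ 2 + 3 * g * m%:R ^+ 2 / q ^+ 2.
Proof.
move=> g0 t0 q0 mt; have := exp_quadratic_bound t0 mt.
have p0 : 0 <= (1 + t) ^+ m by rewrite exprn_ge0 // addr_ge0.
have m0 : 0 <= m%:R :> R by [].
move: p0 m0 mt; move: ((1 + t) ^+ m) (m%:R) => p x p0 x0 xt hp.
have hG : 0 <= g * x ^+ 2 / q ^+ 2 by rewrite !mulr_ge0 ?sqr_ge0 // invr_ge0 sqr_ge0.
have y0 : 0 <= x * t by rewrite mulr_ge0.
have -> : 2 * (p - 1 - x * t) + x * (2 * (t * (p - 1)) + g * x ^+ 2 * (t * p) / q ^+ 2) =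
  2 * (p - 1 - x * t) + 2 * (x * t) * (p - 1) + (g * x ^+ 2 / q ^+ 2) * ((x * t) * p) by ring.
have -> : 3 * g * x ^+ 2 / q ^+ 2 = g * x ^+ 2 / q ^+ 2 * 3 by ring.
move: (g * x ^+ 2 / q ^+ 2) (x * t) hG y0 xt hp => G y G0 y0 y1 hp.
apply: lerD; last by rewrite ler_wpM2l //; nra.
nra.
Qed.

(** [k (k + 1) <= m^2 <= m^4], so the shift stays below [q^2]; [2 q^2] will be the lower bound on
    the expectation of [T] in [Phi]. *)
Lemma casimir_gap_bound (g q : R) m k : 0 <= g -> 24 * g * m%:R ^+ 4 <= q ^+ 2 ->
  (k < m)%N -> q ^+ 2 + g * (k * k.+1)%:R <= 2 * q ^+ 2.
Proof.
move=> g0 hm km; have hk : (k * k.+1 <= m ^ 4)%N.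
  apply: (@leq_trans (m ^ 2)); first by rewrite -mulnn leq_mul // ltnW.
  by rewrite leq_pexp2l // (leq_trans _ km).
have {}hk : (k * k.+1)%:R <= m%:R ^+ 4 :> R by rewrite -natrX ler_nat.
have := ler_wpM2l g0 hk.
have : 0 <= g * m%:R ^+ 4 by rewrite mulr_ge0 ?exprn_ge0.
lra.
Qed.

End Numeric.

(** * Energy of the states [A^m Phi] and [B^m Phi] *)

Section TowerEnergy.
Context {R : realType} {n : nat}.
Implicit Types (A B C T X H : 'M[R[i]]_n) (u v Phi : 'cV[R[i]]_n).

Lemma inner_hermitian H v : H^t* = H ->
  inner v (H *m v) = (complex.Re (inner v (H *m v)))%:C.
Proof. by move=> HH; rewrite RRe_real //; apply/CrealP; rewrite -innerC inner_adj HH. Qed.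

(** Summed over the sites, the first terms of the local differences give [E |A^m Phi|^2], as [Phi]
    is an eigenvector, and the others give the energy. The [A] and [B] parts coincide, hence the
    2. *)
Lemma ladder_energy (L : finType) (h : L -> 'M[R[i]]_n)
    (loc : L -> R -> 'M[R[i]]_n -> Prop) A B C T Phi (g t q c E : R) m :
  let H := \sum_x h x in
  ladder A B C T g%:C -> C *m Phi = 0 -> 0 <= g ->
  (forall x, commutator_stable (loc x) (t * q) A) ->
  (forall x, commutator_stable (loc x) (t * q) B) ->
  0 <= t -> 0 < q ->
  (forall k, (k < m)%N -> q * hnorm (pw A k Phi) <= hnorm (pw A k.+1 Phi)) ->
  (forall x, loc x c (h x)) -> (forall x, (h x)^t* = h x) -> (0 < m)%N ->
  H^t* = H -> H *m Phi = E%:C *: Phi ->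
  inner (pw B m Phi) (H *m pw B m Phi) = inner (pw A m Phi) (H *m pw A m Phi) ->
  2 * `|E * hnorm (pw A m Phi) ^+ 2 - complex.Re (inner (pw A m Phi) (H *m pw A m Phi))| <=
  #|L|%:R * (c * (2 * ((1 + t) ^+ m - 1 - m%:R * t) + m%:R * (2 * (t * ((1 + t) ^+ m - 1)) +
       g * m%:R ^+ 2 * (t * (1 + t) ^+ m) / q ^+ 2)) * hnorm (pw A m Phi) ^+ 2).
Proof.
move=> H lad CP g0 sA sB t0 q0 hgrow hloc hh m0 HH HP sym.
have [AB _ _ _ _] := lad; have BA : B^t* = A by rewrite -AB trmxCK.
set v := pw A m Phi in sym *; set u := pw B m Phi in sym.
set K := c * _ * _.
have site x := ladder_local_energy lad CP g0 (sA x) (sB x) t0 q0 hgrow (hloc x) (hh x) m0.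
have HPl y : inner Phi (H *m y) = E%:C * inner Phi y.
  by rewrite inner_adjr HH HP innerZl; congr (_ * _); exact: conjc_real.
pose F x := inner Phi (h x *m pw B m v) - inner Phi (pw B m (h x *m v)) +
  (inner Phi (h x *m pw A m u) - inner Phi (pw A m (h x *m u))).
have sumF : \sum_x F x = (2 * (E * hnorm v ^+ 2 - complex.Re (inner v (H *m v))))%:C.
  rewrite big_split !sumrB /= -!inner_suml !HPl (inner_pow m Phi v BA) (inner_pow m Phi u AB).
  under [X in _ - X + _]eq_bigr do rewrite (inner_pow _ _ _ BA).
  under [X in _ + (_ - X)]eq_bigr do rewrite (inner_pow _ _ _ AB).
  rewrite -!inner_suml -/v -/u sym !inner_hnorm (ladder_hnorm _ lad CP) -/v (inner_hermitian _ HH).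
  move: (complex.Re _) (hnorm v ^+ 2) => e V.
  by rewrite !(rmorphM, rmorphB) /= rmorph_nat; ring.
have -> : 2 * `|E * hnorm v ^+ 2 - complex.Re (inner v (H *m v))| =
    `|complex.Re (\sum_x F x)| by rewrite sumF /= normrM ger0_norm.
have -> : complex.Re (\sum_x F x) = \sum_x complex.Re (F x).
  exact: (raddf_sum (@complex.Re R : Rcomplex R -> R)).
apply: le_trans (ler_norm_sum _ _ _) _.
rewrite mulr_natl -sumr_const; apply: ler_sum => x _; exact: site.
Qed.

Lemma pw_intertwine (U A B : 'M[R[i]]_n) k v : U *m A = B *m U ->
  U *m pw A k v = pw B k (U *m v).
Proof. by move=> UA; elim: k => // k ih; rewrite !pwS mulmxA UA -mulmxA ih. Qed.

(* The rotation [U] by the angle [pi] about the first axis reverses [C], so that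
   [Phi] has weight 0, and it exchanges the raising and lowering operators. *)
Lemma flip_weight (U O1 O2 C : 'M[R[i]]_n) (g m : R) z Phi : 0 < g -> hnorm Phi = 1 ->
  U^t* *m U = 1%:M -> U *m O1 = O1 *m U -> U *m O2 = - (O2 *m U) ->
  commutator O1 O2 = ('i * g%:C) *: C ->
  C *m Phi = m%:C *: Phi -> U *m Phi = z *: Phi -> cmod z = 1 /\ C *m Phi = 0.
Proof.
move=> g0 P1 UU U1 U2 h12 CP UP.
have z1 : cmod z = 1.
  by have := hnorm_unitary Phi UU; rewrite UP hnormZ P1 mulr1.
split=> //.
have UC : U *m C = - (C *m U).
  have ig : ('i * g%:C : R[i]) != 0.
    by rewrite mulf_neq0 ?neq0Ci // fmorph_eq0 gt_eqF.
  apply: (scalerI ig); rewrite scalemxAr scalerN scalemxAl -h12 /commutator.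
  rewrite mulmxBr mulmxBl !mulmxA U1 U2 mulNmx -!mulmxA U1 U2 mulmxN !mulmxA.
  by rewrite opprB opprK addrC.
have : U *m (C *m Phi) = - (C *m (U *m Phi)) by rewrite mulmxA UC mulNmx mulmxA.
rewrite CP UP -!scalemxAr UP CP !scalerA [z * _]mulrC => /eqP.
rewrite -subr_eq0 opprK -scalerDl -mulr2n scaler_eq0 mulrn_eq0 /= mulf_eq0.
have -> : (z == 0) = false.
  by apply/negP => /eqP zz; move: z1; rewrite zz /cmod normr0 /= => /esym/eqP; rewrite oner_eq0.
rewrite orbF => /orP[/eqP ->|/eqP ->]; first by rewrite scale0r.
by rewrite scaler0.
Qed.

(** [U] maps [A^k Phi] to [z B^k Phi] with [|z| = 1], and it commutes with [H]. *)
Lemma flip_energy (U A B H : 'M[R[i]]_n) z k Phi : U^t* *m U = 1%:M ->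
  U *m A = B *m U -> U *m H = H *m U -> cmod z = 1 -> U *m Phi = z *: Phi ->
  inner (pw B k Phi) (H *m pw B k Phi) = inner (pw A k Phi) (H *m pw A k Phi).
Proof.
move=> UU UA UH z1 UP; set v := pw A k Phi.
have Uv : U *m v = z *: pw B k Phi by rewrite (pw_intertwine _ _ UA) UP pwZ.
have : inner (U *m v) (H *m (U *m v)) = inner v (H *m v).
  by rewrite mulmxA -UH inner_adj -mulmxA [_ *m (U *m _)]mulmxA UU mul1mx.
rewrite Uv -scalemxAr innerZl innerZr mulrA -normCKC cmodE z1 => <-.
by rewrite expr1n mul1r.
Qed.

Lemma tower_energy (L : finType) (h : L -> 'M[R[i]]_n) (o : axis -> L -> 'M[R[i]]_n)
    (H O1 O2 A B C U : 'M[R[i]]_n) Phi z (E mz hb ob g mu N : R) (r m : nat) :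
  H = \sum_x h x -> O1 = \sum_x o axis1 x -> O2 = \sum_x o axis2 x ->
  A = O1 + 'i *: O2 -> B = O1 - 'i *: O2 -> N = #|L|%:R -> (0 < #|L|)%N ->
  0 < hb -> 0 < ob -> 0 < g -> 0 < mu ->
  (forall x, (h x)^t* = h x) -> (forall a x, (o a x)^t* = o a x) -> C^t* = C ->
  commutator O1 C = - ('i *: O2) -> commutator O2 C = 'i *: O1 ->
  hnorm Phi = 1 -> H *m Phi = E%:C *: Phi -> C *m Phi = mz%:C *: Phi ->
  (forall x y a b, x != y -> commutator (o a x) (o b y) = 0) ->
  (forall x, exists S : {set L}, (#|S| <= r)%N /\
     forall y a, y \notin S -> commutator (h x) (o a y) = 0) ->
  (forall x, op_bounded hb (h x)) -> (forall a x, op_bounded ob (o a x)) ->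
  inner Phi (O1 *m O1 *m Phi) = inner Phi (O2 *m O2 *m Phi) ->
  (mu * ob * N) ^+ 2 <= complex.Re (inner Phi (O1 *m O1 *m Phi)) ->
  commutator O1 O2 = ('i * g%:C) *: C ->
  U^t* *m U = 1%:M -> U *m O1 = O1 *m U -> U *m O2 = - (O2 *m U) ->
  U *m H = H *m U -> U *m Phi = z *: Phi ->
  (0 < m)%N -> m%:R * (4 * r%:R) <= mu * N -> 24 * g * m%:R ^+ 4 <= (mu * ob * N) ^+ 2 ->
  [/\ hnorm (pw B m Phi) = hnorm (pw A m Phi),
      inner (pw B m Phi) (H *m pw B m Phi) = inner (pw A m Phi) (H *m pw A m Phi),
      0 < hnorm (pw A m Phi) &
      `|E * hnorm (pw A m Phi) ^+ 2 - complex.Re (inner (pw A m Phi) (H *m pw A m Phi))| <=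
        N * (hb * (48 * (r%:R / mu) ^+ 2 + 3 / 2 * g / (mu * ob) ^+ 2) * (m%:R / N) ^+ 2 *
          hnorm (pw A m Phi) ^+ 2)].
Proof.
move=> HE O1E O2E AE BE NE L0 hb0 ob0 g0 mu0 hh ho aC hC1 hC2 P1 HP CP hcomm hsupp hbB obB
  i12 lro h12 UU U1 U2 UH UP m0 hm1 hm2.
have adj_sum (F : L -> 'M[R[i]]_n) : (forall x, (F x)^t* = F x) ->
    (\sum_x F x)^t* = \sum_x F x.
  move=> hF; apply/matrixP => i j; rewrite !mxE !summxE rmorph_sum.
  by apply: eq_bigr => x _; rewrite -{2}(hF x) !mxE.
have a1 : O1^t* = O1 by rewrite O1E; apply: adj_sum.
have a2 : O2^t* = O2 by rewrite O2E; apply: adj_sum.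
have HH : H^t* = H by rewrite HE; apply: adj_sum.
have [z1 CP0] := flip_weight g0 P1 UU U1 U2 h12 CP UP.
have gJ : (g%:C : R[i])^*%R = g%:C by exact: conjc_real.
have lad := spin_ladder a1 a2 aC gJ hC1 hC2 h12.
rewrite -AE -BE in lad.
have UA : U *m A = B *m U.
  by rewrite AE BE mulmxDr mulmxBl -scalemxAr U1 U2 scalerN scalemxAl.
have N0 : 0 < N by rewrite NE ltr0n.
have [q qE] : exists q, q = mu * ob * N by exists (mu * ob * N).
have q0 : 0 < q by rewrite qE !mulr_gt0.
(* Chosen so that [t * q] is the factor [4 r ob] gained by a local operator in each commutator. *)
have [t tE] : exists t, t = 4 * r%:R * ob / q by exists (4 * r%:R * ob / q).
have ob0' := ltW ob0; have hb0' := ltW hb0; have q0' := ltW q0; have N0' := ltW N0.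
have t0 : 0 <= t by rewrite tE divr_ge0 ?mulr_ge0.
have tq : t * q = 4 * r%:R * ob by rewrite tE divfK ?gt_eqF.
rewrite -qE in lro hm2.
set T := _ + _ in lad.
(* The [C^2] term vanishes at weight 0, and [O1^2] and [O2^2] contribute at least [q^2] each. *)
have TP : 2 * q ^+ 2 <= complex.Re (inner Phi (T *m Phi)).
  rewrite /T 2!mulmxDl -scalemxAl -(mulmxA C C) CP0 mulmx0 scaler0 addr0 innerDr -i12.
  by rewrite mulr_natl mulr2n; move: lro; case: (inner _ _) => x y lro; exact: lerD.
clearbody T.
have gk k : (k < m)%N -> q ^+ 2 + g * (k * k.+1)%:R <= 2 * q ^+ 2.
  exact: casimir_gap_bound (ltW g0) hm2.
have growth := ladder_growth lad CP0 q0 P1 TP gk.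
have hgrow k : (k < m)%N -> q * hnorm (pw A k Phi) <= hnorm (pw A k.+1 Phi).
  by move=> km; have [_] := growth k (ltnW km); apply.
have [v0 _] := growth m (leqnn m).
have sym := flip_energy m UU UA UH z1 UP.
split; [exact: ladder_hnorm lad CP0 | exact: sym | exact: v0 | ].
have [S hS] := choice hsupp.
have stab (w : R[i]) x : cmod w = 1 -> commutator_stable (local o (S x)) (t * q) (O1 + w *: O2).
  move=> w1; rewrite tq O1E O2E.
  exact: local_commutator_stable w1 ob0' obB (hS x).1 hcomm.
have stabA x : commutator_stable (local o (S x)) (t * q) A.
  by rewrite AE; apply: stab; rewrite /cmod normCi.
have stabB x : commutator_stable (local o (S x)) (t * q) B.
  by rewrite BE -scaleNr; apply: stab; rewrite /cmod normrN normCi.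
have locH x : local o (S x) hb (h x).
  by split; [exact: hb0' | exact: hbB | exact: (hS x).2].
have mt : m%:R * t <= 1.
  rewrite tE mulrA ler_pdivrMr // mul1r qE.
  have -> : m%:R * (4 * r%:R * ob) = m%:R * (4 * r%:R) * ob by ring.
  by rewrite (mulrAC mu) ler_pM2r.
have KE := energy_constant_bound (ltW g0) t0 q0 mt.
have := ladder_energy (E := E) lad CP0 (ltW g0) stabA stabB t0 q0 hgrow locH hh m0.
rewrite -HE -NE => /(_ HH HP sym).
have hv2 : 0 <= hnorm (pw A m Phi) ^+ 2 by rewrite sqr_ge0.
(* As [t = 4 r / (mu N)], half of [6 (m t)^2] is [48 (r / mu)^2 (m / N)^2]. *)
have halve (K e V : R) : K <= 6 * (m%:R * t) ^+ 2 + 3 * g * m%:R ^+ 2 / q ^+ 2 -> 0 <= V ->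
    2 * e <= N * (hb * K * V) ->
    e <= N * (hb * (48 * (r%:R / mu) ^+ 2 + 3 / 2 * g / (mu * ob) ^+ 2) * (m%:R / N) ^+ 2 * V).
  move=> KV V0 he.
  have {}he : 2 * e <= N * (hb * (6 * (m%:R * t) ^+ 2 + 3 * g * m%:R ^+ 2 / q ^+ 2) * V).
    by apply: le_trans he _; rewrite ler_wpM2l // ler_wpM2r // ler_wpM2l.
  rewrite -(@ler_pM2l _ 2) //; apply: le_trans he _.
  clear -tE qE N0 mu0 ob0; rewrite le_eqVlt; apply/orP; left; apply/eqP; rewrite tE qE; field.
  by rewrite !gt_eqF.
exact: halve.
Qed.

End TowerEnergy.

(** * The smallness condition on the power, and normalization *)

Section Normalization.
Context {R : realType} {n : nat}.

(** The first bound uses [m <= m^2] and [mu <= 1]; the second is the square of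
    [m^2 sqrt (24 g) <= mu ob N]. *)
Lemma small_power_bounds (ob g mu N : R) (r m : nat) :
  0 < ob -> 0 < g -> 0 < mu <= 1 -> (0 < r)%N -> 0 < N ->
  m%:R ^+ 2 / N <= Num.min (mu ^+ 2 / (192 * r%:R)) (ob * mu / Num.sqrt (24 * g)) ->
  m%:R * (4 * r%:R) <= mu * N /\ 24 * g * m%:R ^+ 4 <= (mu * ob * N) ^+ 2.
Proof.
move=> ob0 g0 /andP[mu0 mu1] r0 N0; rewrite le_min => /andP[h1 h2].
have r0' : 0 < r%:R :> R by rewrite ltr0n.
have m0 : 0 <= m%:R :> R by [].
have mm : m%:R <= m%:R ^+ 2 :> R by rewrite -natrX ler_nat -mulnn; case: (m) => // k; exact: leq_pmulr.
split.
  move: h1; rewrite ler_pdivlMr ?mulr_gt0 // mulrAC ler_pdivrMr // => h1.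
  have : mu ^+ 2 * N <= mu * N by rewrite ler_wpM2r ?(ltW N0) // expr2 ler_piMl // ltW.
  have : 0 <= m%:R ^+ 2 * r%:R :> R by rewrite mulr_ge0 ?exprn_ge0.
  have : m%:R * r%:R <= m%:R ^+ 2 * r%:R :> R by rewrite ler_wpM2r.
  lra.
have s0 : 0 < Num.sqrt (24 * g) by rewrite sqrtr_gt0 mulr_gt0.
have sE : Num.sqrt (24 * g) ^+ 2 = 24 * g by rewrite sqr_sqrtr // mulr_ge0 // ltW.
move: h2; rewrite ler_pdivlMr // mulrAC ler_pdivrMr // => h2.
rewrite -sE (_ : _ * _ = (m%:R ^+ 2 * Num.sqrt (24 * g)) ^+ 2); last by ring.
rewrite ler_pXn2r ?nnegrE ?mulr_ge0 ?exprn_ge0 ?(ltW s0) ?(ltW mu0) ?(ltW ob0) ?(ltW N0) //.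
by rewrite [mu * _]mulrC.
Qed.

Lemma norm_real_complex (x : R) : `|x%:C : R[i]| = `|x|%:C.
Proof. by rewrite normc_def /= expr0n addr0 sqrtr_sqr. Qed.

Lemma normalized_energy (H : 'M[R[i]]_n) (v : 'cV[R[i]]_n) (E N c : R) :
  H^t* = H -> 0 < N -> 0 < hnorm v ->
  `|E * hnorm v ^+ 2 - complex.Re (inner v (H *m v))| <= N * (c * hnorm v ^+ 2) ->
  let Psi := ((hnorm v)^-1)%:C *: v in
  N^-1%:C * `|inner Psi (H *m Psi) - E%:C| <= c%:C.
Proof.
move=> HH N0 v0 hE /=.
rewrite -scalemxAr innerZl innerZr (inner_hermitian _ HH).
rewrite [(_%:C)^*%R](conjc_real (hnorm v)^-1).
move: hE; move: (complex.Re _) (hnorm v) v0 => e a a0 hE.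
have -> : a^-1%:C * (a^-1%:C * e%:C) - E%:C = (a^-1 * (a^-1 * e) - E)%:C.
  by rewrite [RHS]rmorphB /= [(a^-1 * _)%:C]rmorphM /= [(a^-1 * _)%:C]rmorphM.
rewrite norm_real_complex -[_%:C * _%:C](rmorphM (real_complex R)) lecR.
rewrite ler_pdivrMl // -(@ler_pM2r _ (a ^+ 2)) ?exprn_gt0 // -mulrA.
apply: le_trans hE; rewrite -[X in _ * X]ger0_norm ?sqr_ge0 // -normrM distrC.
rewrite le_eqVlt; apply/orP; left; apply/eqP; congr `|_|; field.
by rewrite gt_eqF.
Qed.

End Normalization.

(** * The energy bound for powers of either sign *)

Theorem theorem4 (R : realType) (hbound obound gamma mu : R) (r : nat) :
  0 < hbound -> 0 < obound -> 0 < gamma -> 0 < mu <= 1 -> (2 <= r)%N ->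
  exists c3 : R,
  forall (L : finType) (d : L -> nat)
    (h : L -> op R d) (o : axis -> L -> op R d) (C : op R d)
    (Phi : vec R d) (E : R) (M : int),
  let N := #|L| in
  let H := hamiltonian h in
  let O1 := order_op o axis1 in
  let O2 := order_op o axis2 in
  let U := expmx (('i * (pi / Num.sqrt gamma)%:C) *: O1) in
  let c2 := Num.min (mu ^+ 2 / (192 * r%:R))
                    (obound * mu / Num.sqrt (24 * gamma)) in
  (0 < N)%N ->
  (* self-adjointness, and the algebra of H, C and the order operators *)
  (forall x, h x \is hermsymmx) ->
  (forall a x, o a x \is hermsymmx) ->
  C \is hermsymmx ->
  commutator H C = 0 ->
  commutator O1 C = - ('i *: O2) ->
  commutator O2 C = 'i *: O1 ->
  (* normalized simultaneous eigenstate *)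
  hnorm Phi = 1 ->
  H *m Phi = E%:C *: Phi ->
  (exists m : R, C *m Phi = m%:C *: Phi) ->
  (* i *)
  (forall x y a b, x != y -> commutator (o a x) (o b y) = 0) ->
  (* ii *)
  (forall x, exists S : {set L}, (#|S| <= r)%N /\
     forall y a, y \notin S -> commutator (h x) (o a y) = 0) ->
  (* iii *)
  (forall x, opnorm (h x) <= hbound) ->
  (forall a x, opnorm (o a x) <= obound) ->
  (* iv *)
  inner Phi (O1 ^+ 2 *m Phi) = inner Phi (O2 ^+ 2 *m Phi) ->
  ((mu * obound * N%:R) ^+ 2)%:C <= inner Phi (O1 ^+ 2 *m Phi) ->
  (* v *)
  commutator O1 O2 = ('i * gamma%:C) *: C ->
  (* vi *)
  U *m H *m invmx U = H ->
  (exists z : R[i], U *m Phi = z *: Phi) ->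
  M != 0 ->
  M%:~R ^+ 2 / N%:R <= c2 ->
  let v := raising_pow o M *m Phi in
  let Psi := ((hnorm v)^-1)%:C *: v in
  v <> 0 /\
  (N%:R)^-1 * `|inner Psi (H *m Psi) - E%:C|
    <= (c3 * (M%:~R / N%:R) ^+ 2)%:C.
Proof.
move=> hb0 ob0 g0 mu01 r2.
exists (hbound * (48 * (r%:R / mu) ^+ 2 + 3 / 2 * gamma / (mu * obound) ^+ 2)).
move=> L d h o C Phi E M N H O1 O2 U c2 N0 hh ho hC _ hC1 hC2 P1 HP [mz CP] hcomm hsupp
  hhb hob i12 lro h12 UHU [z UP] M0 hM v Psi.
have [m mE] : exists m, m = `|M|%N by exists `|M|%N.
have m0 : (0 < m)%N by rewrite mE absz_gt0.
have ME : M%:~R ^+ 2 = m%:R ^+ 2 :> R by rewrite mE natr_absz intr_norm real_normK ?num_real.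
have mu0 : 0 < mu by case/andP: mu01.
have r0 : (0 < r)%N by exact: leq_trans r2.
have NR0 : 0 < N%:R :> R by rewrite ltr0n.
rewrite ME in hM.
have [hm1 hm2] := small_power_bounds ob0 g0 mu01 r0 NR0 hM.
have adjh x : (h x)^t* = h x := hermsymmx_adj (hh x).
have adjo a x : (o a x)^t* = o a x := hermsymmx_adj (ho a x).
have hO1 : O1 \is hermsymmx.
  apply/is_hermitianmxP; rewrite expr0 scale1r; apply/matrixP => i j.
  rewrite !mxE !summxE rmorph_sum; apply: eq_bigr => x _.
  by rewrite -{1}(adjo axis1 x) !mxE.
have HH : H^t* = H.
  apply/matrixP => i j; rewrite !mxE !summxE rmorph_sum; apply: eq_bigr => x _.
  by rewrite -{2}(adjh x) !mxE.
(* By v) the inner commutator is [i gamma C], and [[O1, C] = - i O2]. Hence [U] reverses [O2]. *)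
have comm2 : commutator O1 (commutator O1 O2) = gamma%:C *: O2.
  rewrite h12 /commutator -scalemxAr -scalemxAl -scalerBr -/(commutator O1 C) hC1.
  rewrite scalerN scalerA mulrAC -expr2 sqrCi mulN1r scaleNr opprK.
  by [].
have [UU U1 U2] := expmx_rotation g0 hO1 comm2.
rewrite -/U in UU U1 U2.
have UH : U *m H = H *m U.
  have uU : U \in unitmx by have [] := mulmx1_unit UU.
  by rewrite -[in RHS]UHU mulmxKV.
have i12' : inner Phi (O1 *m O1 *m Phi) = inner Phi (O2 *m O2 *m Phi) by [].
have lro' : (mu * obound * N%:R) ^+ 2 <= complex.Re (inner Phi (O1 *m O1 *m Phi)).
  by move: lro; rewrite lecE => /andP[_].
have [nE eE v0 hE] := tower_energy (h := h) (o := o) erefl erefl erefl erefl erefl erefl N0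
  hb0 ob0 g0 mu0 adjh adjo (hermsymmx_adj hC) hC1 hC2 P1 HP CP hcomm hsupp
  (fun x => opnorm_bounded (hhb x)) (fun a x => opnorm_bounded (hob a x)) i12' lro' h12
  UU U1 U2 UH UP m0 hm1 hm2.
(* The sign of [M] only selects one of two vectors of equal norm and energy. *)
have vE : v = pw (raising o) m Phi \/ v = pw (lowering o) m Phi.
  by rewrite /v /raising_pow -mE; case: ifP => _; [left | right]; rewrite pwE.
have {v0 hE} [v0 hE] : 0 < hnorm v /\ `|E * hnorm v ^+ 2 - complex.Re (inner v (H *m v))| <=
    N%:R * (hbound * (48 * (r%:R / mu) ^+ 2 + 3 / 2 * gamma / (mu * obound) ^+ 2) *
      (m%:R / N%:R) ^+ 2 * hnorm v ^+ 2).
  case: vE => ->; first by split; [exact: v0 | exact: hE].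
  by rewrite nE eE; split; [exact: v0 | exact: hE].
split.
  by move=> v00; move: v0; rewrite v00 hnorm0 ltxx.
rewrite [(M%:~R / _) ^+ 2]expr_div_n ME -expr_div_n.
have NC : (N%:R : R[i])^-1 = (N%:R^-1)%:C by rewrite fmorphV rmorph_nat.
rewrite NC; exact: normalized_energy HH NR0 v0 hE.
Qed.
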